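(* Let $\mu>0$ and $\delta\ge0$, and consider the system depending on parameters $\lambda\in\mathbb R$ and $\eta\geq 0$ $$\dot u=v,\qquad \dot v=\mu u+\delta u^2-u^3+\eta(\lambda v+2\delta uv-3u^2v)+\eta^2(\delta v^2-3uv^2)-\eta^3v^3 .$$ For $\eta=0$ this system has two homoclinic orbits $\Gamma_0^{+}$ and $\Gamma_0^-$ to the hyperbolic saddle at the origin, both lying on the level set $H=0$ of $H(u,v)=\frac12v^2-\frac\mu2u^2-\frac\delta3u^3+\frac14u^4$, and given, with $\alpha_0=\sqrt{\mu/(2\delta^2+9\mu)}$, by $$\Gamma_0^\pm:\quad u^\pm(t)=-\frac{3\sqrt2\,\mu\alpha_0}{\sqrt2\,\delta\alpha_0\mp\sqrt\mu\cosh(\sqrt\mu\,t)},\qquad v^\pm(t)=\mp\frac{3\sqrt2\,\mu^2\alpha_0\sinh(\sqrt\mu\,t)}{\big(\sqrt2\,\delta\alpha_0\mp\sqrt\mu\cosh(\sqrt\mu\,t)\big)^2}.$$ For each choice of sign and all sufficiently small $\eta>0$, the homoclinic orbit $\Gamma_0^\pm$ to the origin persists for the parameter value $$\lambda=\lambda^\pm(\delta,\mu)+\mathcal O(\eta),$$ where $$\lambda^\pm(\delta,\mu)=\frac{3I_2^\pm-2\delta I_1^\pm}{I_0^\pm}=\frac{5\sqrt2\,\delta(2\delta^2+9\mu)^2\arctan(\theta^\pm)+3\sqrt\mu\,(10\delta^4+75\delta^2\mu+108\mu^2)}{15\left(\sqrt2\,\delta(2\delta^2+9\mu)\arctan(\theta^\pm)+3\sqrt\mu\,(\delta^2+3\mu)\right)},\qquad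 \theta^\pm=\frac{\sqrt2\,\delta\pm\sqrt{2\delta^2+9\mu}}{3\sqrt\mu},$$ and $I_k^\pm=\int_{-\infty}^\infty (u^\pm(t))^k(v^\pm(t))^2\,dt$ for $k=0,1,2$.
   Context: ''The homoclinic orbit $\Gamma_0^\pm$ persists for $\lambda=\lambda^\pm(\delta,\mu)+\mathcal O(\eta)$'' means: with $\delta,\mu$ fixed, there are $\eta_0>0$ and a function $\eta\mapsto\hat\lambda^\pm(\eta)$ on $(0,\eta_0)$ with $\hat\lambda^\pm(\eta)=\lambda^\pm(\delta,\mu)+\mathcal O(\eta)$ as $\eta\to0$, such that for $0<\eta<\eta_0$ and $\lambda=\hat\lambda^\pm(\eta)$ the system has a homoclinic orbit to the origin that is close to $\Gamma_0^\pm$ and tends to it as $\eta\to0$. In all formulas upper signs correspond to $\Gamma_0^+$ and lower signs to $\Gamma_0^-$. *)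

(* Defs.v *)
From Stdlib Require Import Reals.
From Coquelicot Require Import Coquelicot.
Open Scope R_scope.

(* Choice of the upper or lower sign; [pm s] is the value of "±" and
   [- pm s] the value of "∓". *)
Inductive loop_sign : Set := Upper | Lower.

Definition pm (s : loop_sign) : R :=
  match s with Upper => 1 | Lower => -1 end.

Definition field_u (mu delta lambda eta u v : R) : R := v.

Definition field_v (mu delta lambda eta u v : R) : R :=
  mu * u + delta * u ^ 2 - u ^ 3
  + eta * (lambda * v + 2 * delta * u * v - 3 * u ^ 2 * v)
  + eta ^ 2 * (delta * v ^ 2 - 3 * u * v ^ 2)
  - eta ^ 3 * v ^ 3.

Definition solution (mu delta lambda eta : R) (u v : R -> R) : Prop :=
  forall t : R,
    is_derive u t (field_u mu delta lambda eta (u t) (v t)) /\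
    is_derive v t (field_v mu delta lambda eta (u t) (v t)).

Definition homoclinic_solution (mu delta lambda eta : R) (u v : R -> R) : Prop :=
  solution mu delta lambda eta u v /\
  (exists t : R, (u t, v t) <> (0, 0)) /\
  is_lim u m_infty 0 /\ is_lim v m_infty 0 /\
  is_lim u p_infty 0 /\ is_lim v p_infty 0.

Definition orbit (u v : R -> R) (x y : R) : Prop :=
  exists t : R, x = u t /\ y = v t.

(* [l] is an eigenvalue of the matrix ((a, b), (c, d)). *)
Definition eigenvalue2 (a b c d l : R) : Prop :=
  exists p q : R,
    (p, q) <> (0, 0) /\ a * p + b * q = l * p /\ c * p + d * q = l * q.

Definition hyperbolic_saddle (f g : R -> R -> R) (x y : R) : Prop :=
  f x y = 0 /\ g x y = 0 /\
  exists a b c d : R,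
    differentiable_pt_lim f x y a b /\
    differentiable_pt_lim g x y c d /\
    exists l1 l2 : R,
      l1 < 0 /\ 0 < l2 /\ eigenvalue2 a b c d l1 /\ eigenvalue2 a b c d l2.

Definition Hfun (mu delta u v : R) : R :=
  1 / 2 * v ^ 2 - mu / 2 * u ^ 2 - delta / 3 * u ^ 3 + 1 / 4 * u ^ 4.

Definition alpha0 (mu delta : R) : R := sqrt (mu / (2 * delta ^ 2 + 9 * mu)).

Definition u0 (s : loop_sign) (mu delta t : R) : R :=
  - (3 * sqrt 2 * mu * alpha0 mu delta
     / (sqrt 2 * delta * alpha0 mu delta - pm s * sqrt mu * cosh (sqrt mu * t))).

Definition v0 (s : loop_sign) (mu delta t : R) : R :=
  - pm s * (3 * sqrt 2 * mu ^ 2 * alpha0 mu delta * sinh (sqrt mu * t)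
     / (sqrt 2 * delta * alpha0 mu delta - pm s * sqrt mu * cosh (sqrt mu * t)) ^ 2).

Definition Gamma0 (s : loop_sign) (mu delta : R) : R -> R -> Prop :=
  orbit (u0 s mu delta) (v0 s mu delta).

Definition I_integrand (k : nat) (s : loop_sign) (mu delta t : R) : R :=
  u0 s mu delta t ^ k * v0 s mu delta t ^ 2.

(* [RInt_gen] is a total function: it is meaningful only where the improper
   integral converges. *)
Definition I_int (k : nat) (s : loop_sign) (mu delta : R) : R :=
  RInt_gen (I_integrand k s mu delta) (Rbar_locally m_infty) (Rbar_locally p_infty).

Definition lambda_pm (s : loop_sign) (mu delta : R) : R :=
  (3 * I_int 2 s mu delta - 2 * delta * I_int 1 s mu delta) / I_int 0 s mu delta.

Definition theta (s : loop_sign) (mu delta : R) : R :=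
  (sqrt 2 * delta + pm s * sqrt (2 * delta ^ 2 + 9 * mu)) / (3 * sqrt mu).

Definition lambda_num (s : loop_sign) (mu delta : R) : R :=
  5 * sqrt 2 * delta * (2 * delta ^ 2 + 9 * mu) ^ 2 * atan (theta s mu delta)
  + 3 * sqrt mu * (10 * delta ^ 4 + 75 * delta ^ 2 * mu + 108 * mu ^ 2).

Definition lambda_den (s : loop_sign) (mu delta : R) : R :=
  15 * (sqrt 2 * delta * (2 * delta ^ 2 + 9 * mu) * atan (theta s mu delta)
        + 3 * sqrt mu * (delta ^ 2 + 3 * mu)).

(* Persistence of the homoclinic solution [(u0 s, v0 s)] along
   [lambda = lam + O(eta)]: for [0 < eta < eta0] the system with
   [lambda = lhat eta] has a homoclinic solution [(U eta, V eta)], and, with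
   time origins chosen suitably, these converge to [(u0 s, v0 s)] uniformly
   on the whole real line as [eta -> 0+]. *)
Definition persists (s : loop_sign) (mu delta lam : R) : Prop :=
  exists (eta0 : R) (lhat : R -> R) (U V : R -> R -> R),
    0 < eta0 /\
    (exists C : R, at_right 0 (fun eta => Rabs (lhat eta - lam) <= C * eta)) /\
    (forall eta : R, 0 < eta < eta0 ->
       homoclinic_solution mu delta (lhat eta) eta (U eta) (V eta)) /\
    (forall eps : posreal,
       at_right 0 (fun eta => forall t : R,
         Rabs (U eta t - u0 s mu delta t) < eps /\
         Rabs (V eta t - v0 s mu delta t) < eps)).

(* Main.v *)
Require Import Defs.
From Stdlib Require Import Reals Lra Lia Psatz ClassicalEpsilon.
From Coquelicot Require Import Coquelicot.
Open Scope R_scope.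

(** Unperturbed system.  Put [om = sqrt mu].  On the level set [H = 0] the
    substitution [W = 1 / u + delta / (3 * mu)] linearises the equation: it
    becomes [W'' = mu * W].  Hence the solutions on this level set that never
    vanish are the translates of [u = / (K * cosh (om * t) - c)] with
    [c = delta / (3 * mu)] and [K ^ 2 = c ^ 2 + 1 / (2 * mu)].  The two signs of
    [K] give the two loops, and [homoclinic_classification] says that there is
    no other homoclinic orbit.  Along a loop the logarithmic slope [l = v / u]
    satisfies [l ^ 2 = mu + 2 * delta / 3 * u - u ^ 2 / 2], so that
    [(l * u ^ n)'] is a polynomial in [u]; together with the primitive of [u],
    an arctangent, these expressions yield primitives of [u ^ k * v ^ 2] and
    the closed form of [lambda_pm] ([moment_integral]).

    Persistence.  Write the perturbed solution as [(u + x, v + y)], where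
    [(u, v)] is the loop, and put [k = eta * lambda].  The equation becomes
      [x'' = q * x + Q + k * v],  [q = mu + 2 * delta * u - 3 * u ^ 2],
    where [Q] collects all the other terms ([forcing]).  The linear equation
    [x'' = q * x] has the decaying solution [v] and a second one that grows
    like [exp (om * Rabs t)], which is explicit here ([sol2]).  Therefore, if
    [Q] decays like [exp (- om / 2 * Rabs t)], the inhomogeneous equation has a
    solution decaying at the same rate exactly when [v] is orthogonal to
    [Q + k * v].  This orthogonality determines [k], and the normalisation
    [y 0 = 0] determines [x]; the resulting triple depends linearly and
    boundedly on [Q] ([response_exists], [response_bound]).

    Substituting the response into [forcing] gives a map [Q => Q], which is a
    contraction with constant of order [eta] on a ball of radius of order
    [eta] ([forcing_lipschitz]).  Its fixed point gives at once the homoclinic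
    solution, the parameter value [k / eta], and convergence to the loop
    uniformly in time.  As [Q] equals
    [eta * (2 * delta * u * v - 3 * u ^ 2 * v)] up to [O(eta ^ 2)],
    orthogonality reads [k * I_0 = eta * (3 * I_2 - 2 * delta * I_1) + O(eta ^ 2)],
    that is [k / eta = lambda_pm + O(eta)] ([loop_persistence]). *)

(** * Derivatives of real functions *)

Lemma der_val (f : R -> R) (t l l' : R) : is_derive f t l -> l = l' -> is_derive f t l'.
Proof. intros H <-; exact H. Qed.

(** The next rules are those of Coquelicot for functions from [R] to [R], stated
    so that their conclusions are written with the operations of [R]: the
    tactic [der] below selects one by the syntactic form of the function. *)
Lemma der_id (t : R) : is_derive (fun s : R => s) t 1.
Proof. apply (is_derive_id (K := R_AbsRing)). Qed.
Lemma der_const (k t : R) : is_derive (fun _ : R => k) t 0.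
Proof. apply (is_derive_const (K := R_AbsRing) k). Qed.
Lemma der_plus (f g : R -> R) (t a b : R) :
  is_derive f t a -> is_derive g t b -> is_derive (fun s => f s + g s) t (a + b).
Proof. intros; apply (is_derive_plus f g); assumption. Qed.
Lemma der_minus (f g : R -> R) (t a b : R) :
  is_derive f t a -> is_derive g t b -> is_derive (fun s => f s - g s) t (a - b).
Proof. intros; apply (is_derive_minus f g); assumption. Qed.
Lemma der_opp (f : R -> R) (t a : R) :
  is_derive f t a -> is_derive (fun s => - f s) t (- a).
Proof. intros; apply (is_derive_opp f); assumption. Qed.
Lemma der_mult (f g : R -> R) (t a b : R) :
  is_derive f t a -> is_derive g t b ->
  is_derive (fun s => f s * g s) t (a * g t + f t * b).
Proof. intros; apply (is_derive_mult f g); auto using Rmult_comm. Qed.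
Lemma der_pow (f : R -> R) (n : nat) (t a : R) :
  is_derive f t a -> is_derive (fun s => f s ^ n) t (INR n * a * f t ^ pred n).
Proof. intros; apply is_derive_pow; assumption. Qed.
Lemma der_inv (f : R -> R) (t a : R) :
  is_derive f t a -> f t <> 0 -> is_derive (fun s => / f s) t (- a / f t ^ 2).
Proof. intros; apply is_derive_inv; assumption. Qed.
Lemma der_div (f g : R -> R) (t a b : R) :
  is_derive f t a -> is_derive g t b -> g t <> 0 ->
  is_derive (fun s => f s / g s) t ((a * g t - f t * b) / g t ^ 2).
Proof. intros; apply is_derive_div; assumption. Qed.
Lemma der_comp (f g : R -> R) (t a b : R) :
  is_derive g t b -> is_derive f (g t) a -> is_derive (fun s => f (g s)) t (b * a).
Proof. intros; apply (is_derive_comp f g); assumption. Qed.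
Lemma der_reflect (f : R -> R) (t a : R) :
  is_derive f (- t) a -> is_derive (fun s => f (- s)) t (- a).
Proof.
intros H; eapply der_val;
  [apply (der_comp f (fun s => - s)); [apply der_opp, der_id | exact H] | ring].
Qed.
Lemma der_exp (k t : R) : is_derive (fun s => exp (k * s)) t (k * exp (k * t)).
Proof. auto_derive; [exact I | ring]. Qed.
Lemma der_cosh (k t : R) : is_derive (fun s => cosh (k * s)) t (k * sinh (k * t)).
Proof.
eapply der_val; [apply (der_comp cosh (fun s => k * s)) | reflexivity].
- eapply der_val; [apply der_mult; [apply der_const | apply der_id] | cbv beta; ring].
- apply is_derive_Reals, derivable_pt_lim_cosh.
Qed.
Lemma der_sinh (k t : R) : is_derive (fun s => sinh (k * s)) t (k * cosh (k * t)).
Proof.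
eapply der_val; [apply (der_comp sinh (fun s => k * s)) | reflexivity].
- eapply der_val; [apply der_mult; [apply der_const | apply der_id] | cbv beta; ring].
- apply is_derive_Reals, derivable_pt_lim_sinh.
Qed.

Lemma continuous_of_derive (f : R -> R) (t a : R) : is_derive f t a -> continuous f t.
Proof. intros H; apply (ex_derive_continuous f t); now exists a. Qed.

Ltac der :=
  cbv beta;
  first
  [ match goal with |- is_derive (fun _ => ?k) _ _ => apply (der_const k) end
  | lazymatch goal with
  | |- is_derive (fun s => s) _ _ => apply der_id
  | |- is_derive (fun s => @?f s + @?g s) _ _ => eapply (der_plus f g); der
  | |- is_derive (fun s => @?f s - @?g s) _ _ => eapply (der_minus f g); der
  | |- is_derive (fun s => @?f s * @?g s) _ _ => eapply (der_mult f g); der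
  | |- is_derive (fun s => @?f s / @?g s) _ _ => eapply (der_div f g); [der | der | cbv beta ]
  | |- is_derive (fun s => - @?f s) _ _ => eapply (der_opp f); der
  | |- is_derive (fun s => / @?f s) _ _ => eapply (der_inv f); [der | cbv beta]
  | |- is_derive (fun s => (@?f s) ^ ?n) _ _ => eapply (der_pow f n); der
  | |- is_derive (fun s => exp (?k * s)) _ _ => apply (der_exp k)
  | |- is_derive (fun s => cosh (?k * s)) _ _ => apply (der_cosh k)
  | |- is_derive (fun s => sinh (?k * s)) _ _ => apply (der_sinh k)
  | |- is_derive (fun s => ?f (- s)) _ _ => apply der_reflect; der
  | |- _ =>
    match goal with
      | H : context [is_derive ?f _ _] |- is_derive ?f _ _ => apply H
      | H : context [is_derive ?f _ _] |- is_derive (fun s => ?f s) _ _ => apply H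
    end
  end ].

(** Reduces [is_derive f t l] to an equation between [l] and the derivative
    computed by [der]. *)
Ltac derive := eapply der_val; [der | cbv beta; simpl INR; simpl pred].

Lemma nonincreasing_of_derive (f df : R -> R) (a b : R) :
  a <= b ->
  (forall t, is_derive f t (df t)) -> (forall t, a <= t <= b -> df t <= 0) -> f b <= f a.
Proof.
intros Hab Hd Hs.
destruct (MVT_gen f a b df) as [c [Hc E]].
- intros; apply Hd.
- intros x _; apply continuity_pt_filterlim. exact (continuous_of_derive f x _ (Hd x)).
- rewrite (Rmin_left a b Hab), (Rmax_right a b Hab) in Hc.
  specialize (Hs c Hc). nra.
Qed.

Lemma constant_of_derive (f : R -> R) :
  (forall t, is_derive f t 0) -> forall a b, f a = f b.
Proof.
intros Hd.
assert (W : forall a b, a <= b -> f a = f b).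
{ intros a b Hab. apply Rle_antisym.
  - assert (- f b <= - f a); [|lra].
    apply (nonincreasing_of_derive (fun t => - f t) (fun _ => 0) a b Hab).
    + intros t; derive; ring.
    + intros; lra.
  - apply (nonincreasing_of_derive f (fun _ => 0) a b Hab Hd). intros; lra. }
intros a b; destruct (Rle_dec a b); [auto | symmetry; apply W; lra].
Qed.

(** * Limits at infinity *)

Lemma is_lim_reflect_m (f : R -> R) (l : Rbar) :
  is_lim f m_infty l -> is_lim (fun t => f (- t)) p_infty l.
Proof.
intros H. apply (is_lim_comp f (fun t => - t) p_infty l m_infty H).
- apply (is_lim_opp (fun t => t) p_infty p_infty), is_lim_id.
- now exists 0.
Qed.
Lemma is_lim_reflect_p (f : R -> R) (l : Rbar) :
  is_lim f p_infty l -> is_lim (fun t => f (- t)) m_infty l.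
Proof.
intros H. apply (is_lim_comp f (fun t => - t) m_infty l p_infty H).
- apply (is_lim_opp (fun t => t) m_infty m_infty), is_lim_id.
- now exists 0.
Qed.

Lemma is_lim_exp_neg (k : R) : 0 < k -> is_lim (fun t => exp (- k * t)) p_infty 0.
Proof.
intros Hk. apply (is_lim_comp exp (fun t => - k * t) p_infty 0 m_infty).
- apply is_lim_exp_m.
- evar_last. apply (is_lim_scal_l (fun t => t)), is_lim_id.
  simpl. destruct (Rle_dec 0 (- k)); [exfalso; lra | reflexivity].
- now exists 0.
Qed.

Lemma is_lim_dominated (f g : R -> R) (x : Rbar) :
  (forall t, Rabs (f t) <= g t) -> is_lim g x 0 -> is_lim f x 0.
Proof.
intros Hb Hg. apply (is_lim_le_le_loc (fun t => - g t) g).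
- apply filter_forall. intros t; apply Rabs_le_between, Hb.
- evar_last. apply is_lim_opp, Hg. simpl; f_equal; ring.
- exact Hg.
Qed.

Lemma is_lim_mult_finite (f g : R -> R) (z : Rbar) (x y : R) :
  is_lim f z x -> is_lim g z y -> is_lim (fun t => f t * g t) z (x * y).
Proof. intros Hf Hg. apply (is_lim_mult f g z x y Hf Hg). exact I. Qed.

Lemma is_lim_scal_zero (f : R -> R) (z : Rbar) (c : R) :
  is_lim f z 0 -> is_lim (fun t => c * f t) z 0.
Proof.
intros Hf. evar_last; [apply is_lim_mult_finite; [apply is_lim_const | exact Hf]|].
f_equal; ring.
Qed.

Lemma is_lim_pow_zero (f : R -> R) (n : nat) (z : Rbar) :
  is_lim f z 0 -> is_lim (fun t => f t ^ S n) z 0.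
Proof.
intros Hf; induction n as [|n IH]; simpl;
  (evar_last; [apply is_lim_mult_finite; [exact Hf|]|]).
- apply is_lim_const.
- f_equal; ring.
- exact IH.
- f_equal; ring.
Qed.

Lemma limit_of_constant (f : R -> R) (z : Rbar) (l : R) :
  (forall t, is_derive f t 0) -> is_lim f z l -> forall t, f t = l.
Proof.
intros Hd Hl t.
assert (H : is_lim (fun _ => f t) z l).
{ eapply is_lim_ext; [|exact Hl]. intros s; apply (constant_of_derive f Hd). }
apply is_lim_unique in H. rewrite Lim_const in H. now injection H.
Qed.

(** * Exponential weights and primitives *)

(** The parameter may be negative, for bounds by growing exponentials. *)
Definition weight (k t : R) : R := exp (- k * Rabs t).

Lemma weight_pos k t : 0 < weight k t.
Proof. apply exp_pos. Qed.
Lemma weight_le_1 k t : 0 <= k -> weight k t <= 1.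
Proof.
intros Hk; unfold weight; rewrite <- exp_0.
assert (H : - k * Rabs t <= 0) by (generalize (Rabs_pos t); nra).
destruct H as [H|H]; [left; now apply exp_increasing | rewrite H; lra].
Qed.
Lemma weight_mult j k t : weight j t * weight k t = weight (j + k) t.
Proof. unfold weight; rewrite <- exp_plus; f_equal; ring. Qed.
Lemma weight_reflect k t : weight k (- t) = weight k t.
Proof. unfold weight; now rewrite Rabs_Ropp. Qed.
Lemma weight_right k t : 0 <= t -> weight k t = exp (- k * t).
Proof. intros; unfold weight; now rewrite Rabs_pos_eq. Qed.

Lemma weight_lim_p k : 0 < k -> is_lim (weight k) p_infty 0.
Proof.
intros Hk. apply (is_lim_ext_loc (fun t => exp (- k * t))).
- exists 0; intros t Ht; rewrite weight_right; auto; lra.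
- now apply is_lim_exp_neg.
Qed.
Lemma weight_lim_m k : 0 < k -> is_lim (weight k) m_infty 0.
Proof.
intros Hk. apply (is_lim_ext (fun t => weight k (- t))).
- intros; apply weight_reflect.
- now apply is_lim_reflect_p, weight_lim_p.
Qed.

(** [F t - M / k * exp (- k * t)] and [- F t - M / k * exp (- k * t)] are
    nondecreasing for [t >= 0] and tend to 0, so they are nonpositive.  Working
    with primitives that vanish at infinity avoids improper integrals. *)
Lemma tail_bound_right (F g : R -> R) (k M : R) :
  0 < k -> (forall t, is_derive F t (g t)) ->
  (forall t, 0 <= t -> Rabs (g t) <= M * exp (- k * t)) ->
  is_lim F p_infty 0 ->
  forall t, 0 <= t -> Rabs (F t) <= M / k * exp (- k * t).
Proof.
intros Hk.
assert (W : forall F g : R -> R, (forall t, is_derive F t (g t)) ->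
  (forall t, 0 <= t -> Rabs (g t) <= M * exp (- k * t)) ->
  is_lim F p_infty 0 ->
  forall t, 0 <= t -> F t <= M / k * exp (- k * t)).
{ clear F g; intros F g Hd Hb Hl t Ht.
  assert (Hlim : is_lim (fun s => M / k * exp (- k * s) - F s) p_infty 0).
  { evar_last.
    - apply is_lim_minus'; [apply is_lim_scal_zero, is_lim_exp_neg, Hk | exact Hl].
    - f_equal; ring. }
  assert (0 <= M / k * exp (- k * t) - F t); [|lra].
  apply (is_lim_le_loc (fun s => M / k * exp (- k * s) - F s)
           (fun _ => M / k * exp (- k * t) - F t) p_infty 0
            (M / k * exp (- k * t) - F t)); [|exact Hlim|apply is_lim_const].
  exists t; intros s Hs.
  apply (nonincreasing_of_derive (fun s => M / k * exp (- k * s) - F s)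
           (fun s => - M * exp (- k * s) - g s) t s); [lra| |].
  - intros r; derive; field; lra.
  - intros r Hr. specialize (Hb r ltac:(lra)).
    generalize (Rle_abs (- g r)); rewrite Rabs_Ropp; lra. }
intros Hd Hb Hl t Ht. apply Rabs_le; split.
- assert (- F t <= M / k * exp (- k * t)); [|lra].
  apply (W (fun t => - F t) (fun t => - g t)); auto.
  + intros; derive; ring.
  + intros; rewrite Rabs_Ropp; auto.
  + evar_last; [apply is_lim_opp, Hl|simpl; f_equal; ring].
- apply (W F g); auto.
Qed.

Lemma tail_bound (F g : R -> R) (k M : R) :
  0 < k -> (forall t, is_derive F t (g t)) ->
  (forall t, Rabs (g t) <= M * weight k t) ->
  is_lim F m_infty 0 -> is_lim F p_infty 0 ->
  forall t, Rabs (F t) <= M / k * weight k t.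
Proof.
intros Hk Hd Hb Hm Hp t. destruct (Rle_dec 0 t) as [Ht|Ht].
- rewrite weight_right by exact Ht.
  apply (tail_bound_right F g); auto.
  intros s Hs; rewrite <- weight_right; auto.
- rewrite <- (Ropp_involutive t), weight_reflect, (weight_right _ (- t)) by lra.
  apply (tail_bound_right (fun s => F (- s)) (fun s => - g (- s))); auto; try lra.
  + intros s; apply der_reflect, Hd.
  + intros s Hs; rewrite Rabs_Ropp, <- weight_right, <- (weight_reflect k s); auto.
  + now apply is_lim_reflect_m.
Qed.

Lemma growth_bound_right (F g : R -> R) (k M : R) :
  0 < k -> (forall t, is_derive F t (g t)) ->
  (forall t, 0 <= t -> Rabs (g t) <= M * exp (k * t)) -> F 0 = 0 ->
  forall t, 0 <= t -> Rabs (F t) <= M / k * exp (k * t).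
Proof.
intros Hk Hd0 Hb0 H00.
assert (HM : 0 <= M).
{ specialize (Hb0 0 (Rle_refl 0)). rewrite Rmult_0_r, exp_0 in Hb0.
  generalize (Rabs_pos (g 0)); lra. }
assert (HMk : 0 <= M / k) by (apply Rdiv_le_0_compat; lra).
revert F g Hd0 Hb0 H00.
assert (W : forall F g : R -> R, (forall t, is_derive F t (g t)) ->
  (forall t, 0 <= t -> Rabs (g t) <= M * exp (k * t)) -> F 0 = 0 ->
  forall t, 0 <= t -> F t <= M / k * exp (k * t)).
{ intros F g Hd Hb H0 t Ht.
  assert (F t - M / k * exp (k * t) <= F 0 - M / k * exp (k * 0)).
  { apply (nonincreasing_of_derive (fun s => F s - M / k * exp (k * s))
           (fun s => g s - M * exp (k * s)) 0 t); [lra| |].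
    - intros r; derive; field; lra.
    - intros r Hr. specialize (Hb r ltac:(lra)). generalize (Rle_abs (g r)); lra. }
  rewrite H0, Rmult_0_r, exp_0 in H. lra. }
intros F g Hd Hb H0 t Ht. apply Rabs_le; split.
- assert (- F t <= M / k * exp (k * t)); [|lra].
  apply (W (fun t => - F t) (fun t => - g t)); auto; try lra.
  + intros; derive; ring.
  + intros; rewrite Rabs_Ropp; auto.
- apply (W F g); auto.
Qed.

Lemma growth_bound (F g : R -> R) (k M : R) :
  0 < k -> (forall t, is_derive F t (g t)) ->
  (forall t, Rabs (g t) <= M * weight (- k) t) -> F 0 = 0 ->
  forall t, Rabs (F t) <= M / k * weight (- k) t.
Proof.
intros Hk Hd Hb H0 t.
assert (Wr : forall s, 0 <= s -> weight (- k) s = exp (k * s)).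
{ intros; rewrite weight_right, Ropp_involutive; auto. }
destruct (Rle_dec 0 t) as [Ht|Ht].
- rewrite Wr by exact Ht.
  apply (growth_bound_right F g); auto.
  intros s Hs; rewrite <- Wr; auto.
- rewrite <- (Ropp_involutive t), weight_reflect, (Wr (- t)) by lra.
  apply (growth_bound_right (fun s => F (- s)) (fun s => - g (- s))); auto; try lra.
  + intros s; apply der_reflect, Hd.
  + intros s Hs; rewrite Rabs_Ropp, <- Wr, <- (weight_reflect (- k) s); auto.
  + now rewrite Ropp_0.
Qed.

(** The increment of [F] between [s] and any later time is at most
    [M / k * exp (- k * s)], which is the Cauchy criterion at infinity. *)
Lemma primitive_lim_right (F g : R -> R) (k M : R) :
  0 < k -> (forall t, is_derive F t (g t)) ->
  (forall t, 0 <= t -> Rabs (g t) <= M * exp (- k * t)) ->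
  exists l : R, is_lim F p_infty l.
Proof.
intros Hk Hd Hb.
assert (HM : 0 <= M).
{ specialize (Hb 0 (Rle_refl 0)). rewrite Rmult_0_r, exp_0 in Hb.
  generalize (Rabs_pos (g 0)); lra. }
assert (HMk : 0 <= M / k) by (apply Rdiv_le_0_compat; lra).
assert (W : forall s t, 0 <= s -> s <= t -> Rabs (F t - F s) <= M / k * exp (- k * s)).
{ assert (W : forall (F g : R -> R), (forall t, is_derive F t (g t)) ->
     (forall t, 0 <= t -> Rabs (g t) <= M * exp (- k * t)) ->
     forall s t, 0 <= s -> s <= t -> F t - F s <= M / k * exp (- k * s)).
  { clear F g Hd Hb; intros F g Hd Hb s t Hs Hst.
    assert (F t + M / k * exp (- k * t) <= F s + M / k * exp (- k * s)).
    { apply (nonincreasing_of_derive (fun s => F s + M / k * exp (- k * s))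
           (fun s => g s - M * exp (- k * s)) s t); [lra| |].
      - intros r; derive; field; lra.
      - intros r Hr. specialize (Hb r ltac:(lra)). generalize (Rle_abs (g r)); lra. }
    generalize (exp_pos (- k * t)); nra. }
  intros s t Hs Hst; apply Rabs_le; split.
  - generalize (W (fun t => - F t) (fun t => - g t)); intros W'.
    assert (- F t - - F s <= M / k * exp (- k * s)); [|lra].
    apply W'; auto.
    + intros; derive; ring.
    + intros; rewrite Rabs_Ropp; auto.
  - apply (W F g); auto. }
apply (filterlim_locally_cauchy (F := Rbar_locally' p_infty) F).
intros eps.
assert (Hlim : is_lim (fun t => M / k * exp (- k * t)) p_infty 0).
{ now apply is_lim_scal_zero, is_lim_exp_neg. }
apply is_lim_spec in Hlim. destruct (Hlim eps) as [T HT].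
exists (fun t => Rmax 0 T < t). split; [now exists (Rmax 0 T)|].
assert (V : forall s t, Rmax 0 T < s -> s <= t -> Rabs (F t - F s) < eps).
{ intros s t Hs Hst. eapply Rle_lt_trans; [apply W; [|exact Hst]|].
  - generalize (Rmax_l 0 T); lra.
  - specialize (HT s). rewrite Rminus_0_r in HT.
    eapply Rle_lt_trans; [apply Rle_abs|]. apply HT. generalize (Rmax_r 0 T); lra. }
intros s t Hs Ht. unfold ball; simpl; unfold AbsRing_ball, abs, minus, plus, opp; simpl.
destruct (Rle_dec s t).
- apply V; auto.
- rewrite <- Rabs_Ropp. replace (- (F t + - F s)) with (F s - F t) by ring. apply V; auto; lra.
Qed.

Lemma primitive_exists (g : R -> R) :
  (forall t, continuous g t) -> exists F : R -> R, F 0 = 0 /\ forall t, is_derive F t (g t).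
Proof.
intros Hc. exists (fun t => RInt g 0 t). split.
- apply (RInt_point 0 g).
- intros t. apply (is_derive_RInt g (fun t => RInt g 0 t) 0 t); [|apply Hc].
  apply filter_forall. intros s. apply (RInt_correct g 0 s).
  apply (ex_RInt_continuous g). intros; apply Hc.
Qed.

Lemma primitive_limits (F g : R -> R) (k M : R) :
  0 < k -> (forall t, is_derive F t (g t)) ->
  (forall t, Rabs (g t) <= M * weight k t) ->
  exists l r : R, is_lim F m_infty l /\ is_lim F p_infty r.
Proof.
intros Hk Hd Hb.
destruct (primitive_lim_right F g k M Hk Hd) as [r Hr].
{ intros s Hs; rewrite <- weight_right; auto. }
destruct (primitive_lim_right (fun t => F (- t)) (fun t => - g (- t)) k M Hk) as [l Hl].
{ intros; apply der_reflect, Hd. }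
{ intros s Hs; rewrite Rabs_Ropp, <- weight_right, <- (weight_reflect k s); auto. }
exists l, r; split; [|exact Hr].
apply is_lim_reflect_p in Hl. eapply is_lim_ext; [|exact Hl].
intros t; cbv beta; now rewrite Ropp_involutive.
Qed.

(** Here [r - l] is the integral of [g] over the real line. *)
Lemma total_bound (F g : R -> R) (k M l r : R) :
  0 < k -> (forall t, is_derive F t (g t)) ->
  (forall t, Rabs (g t) <= M * weight k t) ->
  is_lim F m_infty l -> is_lim F p_infty r ->
  Rabs (r - l) <= 2 * M / k.
Proof.
intros Hk Hd Hb Hl Hr.
assert (E : M / k = M / k * exp (- k * 0)) by (rewrite Rmult_0_r, exp_0; ring).
assert (A : Rabs (F 0 - r) <= M / k).
{ rewrite E. apply (tail_bound_right (fun t => F t - r) g k M Hk); try lra.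
  - intros t; derive; ring.
  - intros s Hs; rewrite <- weight_right; auto.
  - evar_last; [apply is_lim_minus'; [exact Hr | apply is_lim_const]|].
    f_equal; ring. }
assert (B : Rabs (F (- 0) - l) <= M / k).
{ rewrite E.
  apply (tail_bound_right (fun t => F (- t) - l) (fun t => - g (- t)) k M Hk); try lra.
  - intros t; derive; ring.
  - intros s Hs; rewrite Rabs_Ropp, <- weight_right, <- (weight_reflect k s); auto.
  - evar_last; [apply is_lim_minus'; [apply is_lim_reflect_m, Hl | apply is_lim_const]|].
    f_equal; ring. }
rewrite Ropp_0 in B.
replace (r - l) with ((F 0 - l) - (F 0 - r)) by ring.
replace (2 * M / k) with (M / k + M / k) by (field; lra).
eapply Rle_trans; [apply Rabs_triang|]. rewrite Rabs_Ropp. lra.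
Qed.

(** * A contraction principle in a weighted space *)

Lemma half_pow_small (D eps : R) :
  0 <= D -> 0 < eps -> exists N, D * (1 / 2) ^ N < eps.
Proof.
intros HD Heps. destruct (pow_lt_1_zero (1 / 2)) with (y := eps / (D + 1)) as [N HN].
- rewrite Rabs_pos_eq; lra.
- apply Rdiv_lt_0_compat; lra.
- exists N. specialize (HN N (le_n N)).
  assert (0 < (1 / 2) ^ N) by (apply pow_lt; lra).
  rewrite Rabs_pos_eq in HN by lra. apply Rlt_div_r in HN; lra.
Qed.

Lemma geometric_limit (s : nat -> R) (D : R) :
  (forall n, Rabs (s (S n) - s n) <= D * (1 / 2) ^ n) ->
  exists l : R, forall n, Rabs (s n - l) <= 2 * D * (1 / 2) ^ n.
Proof.
intros H.
assert (HD : 0 <= D) by (generalize (H 0%nat) (Rabs_pos (s 1%nat - s 0%nat)); simpl; lra).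
assert (C : forall n p, Rabs (s (n + p)%nat - s n) <= 2 * D * (1 / 2) ^ n).
{ intros n p.
  assert (Rabs (s (n + p)%nat - s n) <= 2 * D * (1 / 2) ^ n - 2 * D * (1 / 2) ^ (n + p)).
  { induction p as [|p IH].
    - rewrite Nat.add_0_r, Rminus_diag, Rabs_R0; lra.
    - rewrite Nat.add_succ_r. specialize (H (n + p)%nat). simpl pow.
      replace (s (S (n + p)) - s n) with ((s (S (n + p)) - s (n + p)%nat) + (s (n + p)%nat - s n)) by ring.
      eapply Rle_trans; [apply Rabs_triang|]. lra. }
  assert (0 <= (1 / 2) ^ (n + p)) by (apply pow_le; lra). nra. }
assert (Hl : ex_finite_lim_seq s).
{ apply ex_lim_seq_cauchy_corr. intros eps.
  destruct (half_pow_small (4 * D) eps) as [N HE]; [lra|apply cond_pos|].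
  exists N. intros n m Hn Hm.
  generalize (C N (n - N)%nat) (C N (m - N)%nat).
  replace (N + (n - N))%nat with n by lia. replace (N + (m - N))%nat with m by lia.
  intros A B.
  replace (s n - s m) with ((s n - s N) - (s m - s N)) by ring.
  eapply Rle_lt_trans; [apply Rabs_triang|]. rewrite Rabs_Ropp. lra. }
destruct Hl as [l Hl]. exists l. intros n.
apply (is_lim_seq_le (fun p => Rabs (s n - s (p + n)%nat)) (fun _ => 2 * D * (1 / 2) ^ n)
   (Rabs (s n - l)) (2 * D * (1 / 2) ^ n)).
- intros p. rewrite Rabs_minus_sym, Nat.add_comm. apply C.
- apply (is_lim_seq_abs _ (s n - l)).
  apply is_lim_seq_minus'; [apply is_lim_seq_const|].
  apply (is_lim_seq_incr_n s n), Hl.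
- apply is_lim_seq_const.
Qed.

Lemma continuous_uniform_limit (f : nat -> R -> R) (g : R -> R) (D : R) :
  (forall n t, continuous (f n) t) ->
  (forall n t, Rabs (f n t - g t) <= D * (1 / 2) ^ n) ->
  forall t, continuous g t.
Proof.
intros Hf Hu t.
assert (HD : 0 <= D) by (generalize (Hu 0%nat 0) (Rabs_pos (f 0%nat 0 - g 0)); simpl; lra).
apply filterlim_locally. intros eps.
destruct (half_pow_small (4 * D) eps) as [N HE]; [lra|apply cond_pos|].
assert (He2 : 0 < eps / 2) by (generalize (cond_pos eps); lra).
generalize (proj1 (filterlim_locally (f N) (f N t)) (Hf N t) (mkposreal _ He2)).
apply filter_imp. intros s Hs.
change (Rabs (f N s - f N t) < eps / 2) in Hs.
change (Rabs (g s - g t) < eps).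
replace (g s - g t) with ((f N s - f N t) - (f N s - g s) + (f N t - g t)) by ring.
eapply Rle_lt_trans; [apply Rabs_triang|].
eapply Rle_lt_trans; [apply Rplus_le_compat_r, Rabs_triang|].
rewrite Rabs_Ropp. generalize (Hu N s) (Hu N t). lra.
Qed.

Definition admissible (k rho : R) (Q : R -> R) : Prop :=
  (forall t, continuous Q t) /\ forall t, Rabs (Q t) <= rho * weight k t.

(** Iteration from 0.  The iterates converge at each [t] at a geometric rate, and
    the limits satisfy the same weighted bounds; since the weight is at most 1,
    the convergence is uniform and the limit is continuous. *)
Lemma weighted_contraction (k rho : R) (Phi : (R -> R) -> R -> R) :
  0 <= k -> 0 <= rho ->
  (forall Q, admissible k rho Q -> admissible k rho (Phi Q)) ->
  (forall P Q e, admissible k rho P -> admissible k rho Q ->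
     (forall t, Rabs (P t - Q t) <= e * weight k t) ->
     forall t, Rabs (Phi P t - Phi Q t) <= 1 / 2 * e * weight k t) ->
  exists Q, admissible k rho Q /\ forall t, Phi Q t = Q t.
Proof.
intros Hk Hrho Hself Hcontr.
pose (it := fix it (n : nat) : R -> R :=
   match n with O => fun _ => 0 | S n => Phi (it n) end).
assert (Hadm : forall n, admissible k rho (it n)).
{ induction n as [|n IH]; [|apply Hself, IH]. split.
  - intros t; apply continuous_const.
  - intros t; simpl; rewrite Rabs_R0. generalize (weight_pos k t); nra. }
assert (Hstep : forall n t, Rabs (it (S n) t - it n t) <= rho * weight k t * (1 / 2) ^ n).
{ assert (G : forall n t, Rabs (it (S n) t - it n t) <= rho * (1 / 2) ^ n * weight k t).
  { induction n as [|n IH]; intros t.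
    - simpl it at 2. rewrite Rminus_0_r. simpl pow. rewrite Rmult_1_r. apply (Hadm 1%nat).
    - simpl pow. replace (rho * (1 / 2 * (1 / 2) ^ n)) with (1 / 2 * (rho * (1 / 2) ^ n)) by ring.
      apply (Hcontr (it (S n)) (it n)); auto. }
  intros n t. generalize (G n t). lra. }
assert (Hlim : exists Q : R -> R, forall n t, Rabs (it n t - Q t) <= 2 * rho * weight k t * (1 / 2) ^ n).
{ exists (fun t => epsilon (inhabits 0)
     (fun l => forall n, Rabs (it n t - l) <= 2 * rho * weight k t * (1 / 2) ^ n)).
  intros n t. revert n. apply epsilon_spec.
  destruct (geometric_limit (fun n => it n t) (rho * weight k t)) as [l Hl]; [auto|].
  exists l. intros n; specialize (Hl n); lra. }
destruct Hlim as [Q HQ].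
assert (HQ' : forall n t, Rabs (it n t - Q t) <= (2 * rho) * (1 / 2) ^ n).
{ intros n t. eapply Rle_trans; [apply HQ|].
  apply Rmult_le_compat_r; [apply pow_le; lra|].
  generalize (weight_le_1 k t Hk) (weight_pos k t); nra. }
assert (Hp : forall X Y D : R, (forall n, Rabs (X - Y) <= D * (1 / 2) ^ n) -> X = Y).
{ intros X Y D H.
  assert (H1 : Rabs (X - Y) <= 0).
  { apply (is_lim_seq_le (fun _ => Rabs (X - Y)) (fun n => D * (1 / 2) ^ n)
      (Rabs (X - Y)) 0); auto.
    - apply is_lim_seq_const.
    - evar_last.
      + apply is_lim_seq_scal_l, is_lim_seq_geom. rewrite Rabs_pos_eq; lra.
      + simpl; f_equal; ring. }
  generalize (Rabs_pos (X - Y)); intros H2.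
  destruct (Req_dec (X - Y) 0) as [E|E]; [lra|]. apply Rabs_pos_lt in E. lra. }
assert (HadmQ : admissible k rho Q).
{ split.
  - apply (continuous_uniform_limit it Q (2 * rho)); [intros; apply Hadm|exact HQ'].
  - intros t.
    apply (is_lim_seq_le (fun n => Rabs (Q t) ) (fun n => rho * weight k t + 2 * rho * weight k t * (1 / 2) ^ n)
        (Rabs (Q t)) (rho * weight k t)).
    + intros n. generalize (HQ n t) (proj2 (Hadm n) t). intros H1 H2.
      replace (Q t) with (it n t - (it n t - Q t)) by ring.
      eapply Rle_trans; [apply Rabs_triang|]. rewrite Rabs_Ropp. lra.
    + apply is_lim_seq_const.
    + evar_last.
      * apply is_lim_seq_plus'; [apply is_lim_seq_const|].
        apply (is_lim_seq_scal_l _ (2 * rho * weight k t) 0), is_lim_seq_geom.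
        rewrite Rabs_pos_eq; lra.
      * simpl; f_equal; ring. }
exists Q; split; [exact HadmQ|]. intros t.
apply (Hp _ _ (4 * rho * weight k t)). intros n.
replace (Phi Q t - Q t) with ((Phi Q t - Phi (it n) t) + (it (S n) t - Q t)) by (simpl; ring).
eapply Rle_trans; [apply Rabs_triang|].
assert (H1 : Rabs (Phi Q t - Phi (it n) t) <= 1 / 2 * (2 * rho * (1 / 2) ^ n) * weight k t).
{ apply Hcontr; auto. intros s. rewrite Rabs_minus_sym. generalize (HQ n s); lra. }
generalize (HQ (S n) t). simpl pow.
assert (0 <= rho * weight k t * (1 / 2) ^ n).
{ apply Rmult_le_pos; [|apply pow_le; lra]. generalize (weight_pos k t); nra. }
intros. lra.
Qed.

(** * The linearised equation *)

(** [a] and [b] solve [x'' = q * x] with Wronskian 1; [a] decays and [b] grows at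
    the rate [2 * nu].  The condition [db 0 = 0] makes [y 0 = 0] the condition
    that removes the multiples of [a] from a response. *)
Record fundamental_system (nu M : R) (q a da b db : R -> R) : Prop := {
  fs_nu : 0 < nu;
  fs_M : 0 < M;
  fs_da : forall t, is_derive a t (da t);
  fs_dda : forall t, is_derive da t (q t * a t);
  fs_db : forall t, is_derive b t (db t);
  fs_ddb : forall t, is_derive db t (q t * b t);
  fs_wronskian : forall t, a t * db t - da t * b t = 1;
  fs_db0 : db 0 = 0;
  fs_a_bound : forall t, Rabs (a t) <= M * weight (2 * nu) t;
  fs_da_bound : forall t, Rabs (da t) <= M * weight (2 * nu) t;
  fs_b_bound : forall t, Rabs (b t) <= M * weight (- (2 * nu)) t;
  fs_db_bound : forall t, Rabs (db t) <= M * weight (- (2 * nu)) t }.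
Arguments fs_nu {nu M q a da b db} _.
Arguments fs_M {nu M q a da b db} _.
Arguments fs_da {nu M q a da b db} _ _.
Arguments fs_dda {nu M q a da b db} _ _.
Arguments fs_db {nu M q a da b db} _ _.
Arguments fs_ddb {nu M q a da b db} _ _.
Arguments fs_wronskian {nu M q a da b db} _ _.
Arguments fs_db0 {nu M q a da b db} _.
Arguments fs_a_bound {nu M q a da b db} _ _.
Arguments fs_da_bound {nu M q a da b db} _ _.
Arguments fs_b_bound {nu M q a da b db} _ _.
Arguments fs_db_bound {nu M q a da b db} _ _.

(** A decaying solution [(x, y)] of the inhomogeneous equation
    [x'' = q * x + Q + k * a].  The scalar [k] is part of the unknown: it makes
    the right-hand side orthogonal to [a]. *)
Record response (nu : R) (q a Q x y : R -> R) (k : R) : Prop := {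
  rs_x : forall t, is_derive x t (y t);
  rs_y : forall t, is_derive y t (q t * x t + Q t + k * a t);
  rs_y0 : y 0 = 0;
  rs_decay : exists N, forall t,
    Rabs (x t) <= N * weight nu t /\ Rabs (y t) <= N * weight nu t }.
Arguments rs_x {nu q a Q x y k} _ _.
Arguments rs_y {nu q a Q x y k} _ _.
Arguments rs_y0 {nu q a Q x y k} _.

Lemma Rabs_mult_le (x y X Y : R) :
  Rabs x <= X -> Rabs y <= Y -> Rabs (x * y) <= X * Y.
Proof.
intros; rewrite Rabs_mult; apply Rmult_le_compat; auto using Rabs_pos.
Qed.
Lemma Rabs_plus_le (x y X Y : R) :
  Rabs x <= X -> Rabs y <= Y -> Rabs (x + y) <= X + Y.
Proof. intros; eapply Rle_trans; [apply Rabs_triang|lra]. Qed.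
Lemma Rabs_minus_le (x y X Y : R) :
  Rabs x <= X -> Rabs y <= Y -> Rabs (x - y) <= X + Y.
Proof. intros; apply Rabs_plus_le; [|rewrite Rabs_Ropp]; auto. Qed.
Lemma bound_nonneg (f : R -> R) (k M : R) : (forall t, Rabs (f t) <= M * weight k t) -> 0 <= M.
Proof. intros H. generalize (H 0) (Rabs_pos (f 0)) (weight_pos k 0). nra. Qed.

(** The variation of constants formula [x = b * A + a * B].  The factor [A] decays
    at rate [3 * nu], because it vanishes at both ends, and [B] grows at rate at
    most [nu], so both products decay at rate [nu]. *)
Lemma variation_bound (nu M N : R) (q a da b db G A B : R -> R) :
  fundamental_system nu M q a da b db ->
  (forall t, Rabs (G t) <= N * weight nu t) ->
  (forall t, is_derive A t (a t * G t)) -> is_lim A m_infty 0 -> is_lim A p_infty 0 ->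
  (forall t, is_derive B t (- (b t * G t))) -> B 0 = 0 ->
  forall t, Rabs (b t * A t + a t * B t) <= 2 * M ^ 2 / nu * N * weight nu t /\
            Rabs (db t * A t + da t * B t) <= 2 * M ^ 2 / nu * N * weight nu t.
Proof.
intros FS HG HA HAm HAp HB HB0 t.
assert (Hnu := fs_nu FS). assert (HM := fs_M FS).
assert (HN := bound_nonneg _ _ _ HG).
assert (EA : Rabs (A t) <= M * N / (3 * nu) * weight (3 * nu) t).
{ apply (tail_bound A (fun t => a t * G t)); auto; [lra|]. intros s.
  eapply Rle_trans; [apply Rabs_mult_le; [apply (fs_a_bound FS)|apply HG]|].
  replace (3 * nu) with (2 * nu + nu) by ring. rewrite <- weight_mult. right; ring. }
assert (EB : Rabs (B t) <= M * N / nu * weight (- nu) t).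
{ apply (growth_bound B (fun t => - (b t * G t))); auto. intros s. rewrite Rabs_Ropp.
  eapply Rle_trans; [apply Rabs_mult_le; [apply (fs_b_bound FS)|apply HG]|].
  replace (- nu) with (- (2 * nu) + nu) by ring. rewrite <- weight_mult. right; ring. }
assert (HMN : 0 <= M ^ 2 * N / nu * weight nu t).
{ apply Rmult_le_pos; [|left; apply weight_pos]. apply Rdiv_le_0_compat; [|lra].
  apply Rmult_le_pos; nra. }
assert (F : forall u v, Rabs u <= M * weight (- (2 * nu)) t -> Rabs v <= M * weight (2 * nu) t ->
   Rabs (u * A t + v * B t) <= 2 * M ^ 2 / nu * N * weight nu t).
{ intros u v Hu Hv.
  eapply Rle_trans; [apply Rabs_plus_le; apply Rabs_mult_le; eassumption|].
  replace (M * weight (- (2 * nu)) t * (M * N / (3 * nu) * weight (3 * nu) t))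
    with (M ^ 2 * N / (3 * nu) * (weight (- (2 * nu)) t * weight (3 * nu) t)) by (field; lra).
  replace (M * weight (2 * nu) t * (M * N / nu * weight (- nu) t))
    with (M ^ 2 * N / nu * (weight (2 * nu) t * weight (- nu) t)) by (field; lra).
  rewrite !weight_mult.
  replace (- (2 * nu) + 3 * nu) with nu by ring. replace (2 * nu + - nu) with nu by ring.
  replace (M ^ 2 * N / (3 * nu)) with (1 / 3 * (M ^ 2 * N / nu)) by (field; lra).
  replace (2 * M ^ 2 / nu * N) with (2 * (M ^ 2 * N / nu)) by (field; lra).
  lra. }
split; apply F; apply FS.
Qed.

Lemma response_sub nu q a Q1 Q2 x1 x2 y1 y2 k1 k2 :
  response nu q a Q1 x1 y1 k1 -> response nu q a Q2 x2 y2 k2 ->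
  response nu q a (fun t => Q1 t - Q2 t) (fun t => x1 t - x2 t) (fun t => y1 t - y2 t) (k1 - k2).
Proof.
intros [X1 Y1 Z1 [N1 D1]] [X2 Y2 Z2 [N2 D2]]; split.
- intros t; derive; ring.
- intros t; derive; ring.
- rewrite Z1, Z2; ring.
- exists (N1 + N2); intros t. specialize (D1 t); specialize (D2 t).
  rewrite !Rmult_plus_distr_r. split; apply Rabs_minus_le; tauto.
Qed.

(** The coefficient [A] of [b] is recovered from [x] as the Wronskian of [a] and
    [x]. *)
Lemma response_wronskian {nu M : R} {q a da b db Q x y : R -> R} {k : R} :
  fundamental_system nu M q a da b db -> response nu q a Q x y k ->
  (forall t, is_derive (fun s => a s * y s - da s * x s) t (a t * (Q t + k * a t))) /\
  is_lim (fun s => a s * y s - da s * x s) m_infty 0 /\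
  is_lim (fun s => a s * y s - da s * x s) p_infty 0.
Proof.
intros FS [Hx Hy Hy0 [D HD]].
assert (Hnu := fs_nu FS). assert (HM := fs_M FS).
assert (Hda := fs_da FS). assert (Hdda := fs_dda FS).
assert (HAb : forall t, Rabs (a t * y t - da t * x t) <= 2 * M * D * weight (3 * nu) t).
{ intros t. destruct (HD t) as [Dx Dy].
  eapply Rle_trans.
  - apply Rabs_minus_le; apply Rabs_mult_le;
      [apply (fs_a_bound FS)|exact Dy|apply (fs_da_bound FS)|exact Dx].
  - replace (3 * nu) with (2 * nu + nu) by ring. rewrite <- weight_mult. right; ring. }
assert (Hlim : forall z : Rbar, is_lim (weight (3 * nu)) z 0 ->
  is_lim (fun s => a s * y s - da s * x s) z 0).
{ intros z Hz. apply (is_lim_dominated _ _ z HAb).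
  now apply is_lim_scal_zero. }
split; [intros t; derive; ring|].
split; apply Hlim; [apply weight_lim_m | apply weight_lim_p]; lra.
Qed.

(** Orthogonality of [a] and [Q + k * a]: the Wronskian of [a] and [x] is a
    primitive of [a * (Q + k * a)] and vanishes at both ends.  Here [jr - jl] is the
    integral of [a * Q] and [r - l] that of [a ^ 2]. *)
Lemma response_solvability (nu M : R) (q a da b db Q x y S J : R -> R) (k l r jl jr : R) :
  fundamental_system nu M q a da b db -> response nu q a Q x y k ->
  (forall t, is_derive S t (a t ^ 2)) -> is_lim S m_infty l -> is_lim S p_infty r ->
  (forall t, is_derive J t (a t * Q t)) -> is_lim J m_infty jl -> is_lim J p_infty jr ->
  jr - jl + k * (r - l) = 0.
Proof.
intros FS RS HS Hl Hr HJ Hjl Hjr.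
destruct (response_wronskian FS RS) as [HA [HAm HAp]].
pose (Z := fun t => (a t * y t - da t * x t) - (J t + k * S t)).
assert (HZ : forall t, is_derive Z t 0).
{ intros t; unfold Z. eapply der_val; [apply der_minus; [apply HA | der] | ring]. }
assert (L : forall (z : Rbar) (s j : R), is_lim (fun s => a s * y s - da s * x s) z 0 ->
  is_lim S z s -> is_lim J z j -> is_lim Z z (0 - (j + k * s))).
{ intros z s j H0 H1 H2. apply is_lim_minus'; [exact H0|]. apply is_lim_plus'; [exact H2|].
  apply (is_lim_scal_l S k z s H1). }
generalize (limit_of_constant Z _ _ HZ (L _ _ _ HAm Hl Hjl) 0)
  (limit_of_constant Z _ _ HZ (L _ _ _ HAp Hr Hjr) 0). lra.
Qed.

(** An a priori bound, with a constant depending on the linear equation alone.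
    Orthogonality bounds [k]; then [variation_bound] applies to the two
    coefficients read off from [x] and [y] by Cramer's rule.  Uniqueness and
    Lipschitz dependence on [Q] follow from it through [response_sub]. *)
Lemma response_bound (nu M : R) (q a da b db S : R -> R) (l r : R) :
  fundamental_system nu M q a da b db ->
  (forall t, is_derive S t (a t ^ 2)) -> is_lim S m_infty l -> is_lim S p_infty r ->
  0 < r - l ->
  exists C, 0 < C /\ forall Q x y k N,
    response nu q a Q x y k -> (forall t, Rabs (Q t) <= N * weight nu t) ->
    Rabs k <= C * N /\
    forall t, Rabs (x t) <= C * N * weight nu t /\ Rabs (y t) <= C * N * weight nu t.
Proof.
intros FS HS Hl Hr HI.
assert (Hnu := fs_nu FS). assert (HM := fs_M FS).
pose (C1 := 2 * M / (3 * nu) / (r - l)).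
assert (HC1 : 0 < C1) by (unfold C1; repeat apply Rdiv_lt_0_compat; lra).
pose (C2 := 2 * M ^ 2 / nu * (1 + C1 * M)).
assert (HC2 : 0 < C2).
{ apply Rmult_lt_0_compat; [apply Rdiv_lt_0_compat; nra|nra]. }
exists (C1 + C2); split; [lra|].
intros Q x y k N RS HQ.
assert (Hx := rs_x RS). assert (Hy := rs_y RS).
assert (Hy0 := rs_y0 RS).
assert (HN := bound_nonneg _ _ _ HQ).
pose (A := fun t => a t * y t - da t * x t).
pose (B := fun t => db t * x t - b t * y t).
assert (Hda := fs_da FS). assert (Hdda := fs_dda FS).
assert (Hdb := fs_db FS). assert (Hddb := fs_ddb FS).
destruct (response_wronskian FS RS) as [HA [HAm HAp]].
fold A in HA, HAm, HAp.
assert (HB : forall t, is_derive B t (- (b t * (Q t + k * a t)))).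
{ intros t; unfold B; derive; ring. }
assert (Hk : Rabs k <= C1 * N).
{ assert (T : Rabs ((0 - k * r) - (0 - k * l)) <= 2 * (M * N) / (3 * nu)).
  { apply (total_bound (fun t => A t - k * S t) (fun t => a t * Q t)); [lra| | | |].
    - intros t. eapply der_val; [apply der_minus; [apply HA|der] | ring].
    - intros t. eapply Rle_trans; [apply Rabs_mult_le; [apply (fs_a_bound FS)|apply HQ]|].
      replace (3 * nu) with (2 * nu + nu) by ring. rewrite <- weight_mult. right; ring.
    - apply is_lim_minus'; [exact HAm|apply (is_lim_scal_l S k _ l), Hl].
    - apply is_lim_minus'; [exact HAp|apply (is_lim_scal_l S k _ r), Hr]. }
  replace ((0 - k * r) - (0 - k * l)) with (- (k * (r - l))) in T by ring.
  rewrite Rabs_Ropp, Rabs_mult, (Rabs_pos_eq (r - l)) in T by lra.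
  apply (Rmult_le_reg_r (r - l)); [lra|].
  replace (C1 * N * (r - l)) with (2 * (M * N) / (3 * nu)) by (unfold C1; field; lra).
  exact T. }
assert (HG : forall t, Rabs (Q t + k * a t) <= N * (1 + C1 * M) * weight nu t).
{ intros t. eapply Rle_trans.
  - apply Rabs_plus_le; [apply HQ|apply Rabs_mult_le; [exact Hk|apply (fs_a_bound FS)]].
  - replace (2 * nu) with (nu + nu) by ring. rewrite <- weight_mult.
    generalize (weight_le_1 nu t ltac:(lra)) (weight_pos nu t). intros W1 W2.
    assert (0 <= C1 * N * M * weight nu t).
    { apply Rmult_le_pos; [apply Rmult_le_pos; [apply Rmult_le_pos|]|]; lra. }
    nra. }
assert (V := variation_bound nu M _ q a da b db _ A B FS HG HA HAm HAp HB).
assert (HB0 : B 0 = 0) by (unfold B; rewrite (fs_db0 FS), Hy0; ring).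
specialize (V HB0).
split; [nra|]. intros t. specialize (V t).
assert (W := fs_wronskian FS t).
replace (b t * A t + a t * B t) with (x t) in V.
2: { unfold A, B. transitivity (x t * (a t * db t - da t * b t)); [rewrite W|]; ring. }
replace (db t * A t + da t * B t) with (y t) in V.
2: { unfold A, B. transitivity (y t * (a t * db t - da t * b t)); [rewrite W|]; ring. }
assert (0 <= C1 * N * weight nu t).
{ generalize (weight_pos nu t); intros; apply Rmult_le_pos; [apply Rmult_le_pos|]; lra. }
replace (2 * M ^ 2 / nu * (N * (1 + C1 * M)) * weight nu t) with (C2 * N * weight nu t) in V
  by (unfold C2; ring).
lra.
Qed.

Lemma cont_mult (f g : R -> R) t : continuous f t -> continuous g t -> continuous (fun s => f s * g s) t.
Proof. intros; apply (continuous_mult f g); assumption. Qed.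
Lemma cont_plus (f g : R -> R) t : continuous f t -> continuous g t -> continuous (fun s => f s + g s) t.
Proof. intros; apply (continuous_plus f g); assumption. Qed.

(** The scalar [k] is chosen so that the primitive of [a * (Q + k * a)] vanishing at
    minus infinity also vanishes at plus infinity. *)
Lemma response_exists (nu M : R) (q a da b db S : R -> R) (l r : R) :
  fundamental_system nu M q a da b db ->
  (forall t, is_derive S t (a t ^ 2)) -> is_lim S m_infty l -> is_lim S p_infty r ->
  r - l <> 0 ->
  forall Q N, admissible nu N Q -> exists x y k, response nu q a Q x y k.
Proof.
intros FS HS Hl Hr HI Q N [Qc Qb].
assert (Hnu := fs_nu FS). assert (HM := fs_M FS).
assert (HN := bound_nonneg _ _ _ Qb).
assert (Hda := fs_da FS). assert (Hdda := fs_dda FS).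
assert (Hdb := fs_db FS). assert (Hddb := fs_ddb FS).
assert (ac : forall t, continuous a t) by (intros t; exact (continuous_of_derive a t _ (Hda t))).
assert (bc : forall t, continuous b t) by (intros t; exact (continuous_of_derive b t _ (Hdb t))).
destruct (primitive_exists (fun t => a t * Q t)) as [F [_ HF]].
{ intros t; apply cont_mult; auto. }
destruct (primitive_limits F (fun t => a t * Q t) (3 * nu) (M * N)) as [m [p [Hm Hp]]]; [lra|exact HF| |].
{ intros t. eapply Rle_trans; [apply Rabs_mult_le; [apply (fs_a_bound FS)|apply Qb]|].
  replace (3 * nu) with (2 * nu + nu) by ring. rewrite <- weight_mult. right; ring. }
pose (k := - (p - m) / (r - l)).
pose (A := fun t => (F t - m) + k * (S t - l)).
destruct (primitive_exists (fun t => (- (1)) * (b t * (Q t + k * a t)))) as [B [HB0 HB]].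
{ intros t; apply cont_mult; [apply continuous_const|]. apply cont_mult; auto. apply cont_plus; auto.
  apply cont_mult; auto. apply continuous_const. }
assert (HA : forall t, is_derive A t (a t * (Q t + k * a t))).
{ intros t; unfold A; derive; ring. }
assert (HB' : forall t, is_derive B t (- (b t * (Q t + k * a t)))).
{ intros t; derive; ring. }
assert (Hlim : forall (z : Rbar) (f s : R), is_lim F z f -> is_lim S z s ->
   (f - m) + k * (s - l) = 0 -> is_lim A z 0).
{ intros z f s H1 H2 E. rewrite <- E. apply is_lim_plus'.
  - apply is_lim_minus'; [exact H1|apply is_lim_const].
  - apply (is_lim_scal_l _ k _ (s - l)). apply is_lim_minus'; [exact H2|apply is_lim_const]. }
assert (HG : forall t, Rabs (Q t + k * a t) <= (N + Rabs k * M) * weight nu t).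
{ intros t. eapply Rle_trans.
  - apply Rabs_plus_le; [apply Qb|apply Rabs_mult_le; [apply Rle_refl|apply (fs_a_bound FS)]].
  - replace (2 * nu) with (nu + nu) by ring. rewrite <- weight_mult.
    generalize (weight_le_1 nu t ltac:(lra)) (weight_pos nu t). intros W1 W2.
    assert (0 <= Rabs k * M * weight nu t).
    { repeat apply Rmult_le_pos; auto using Rabs_pos; lra. }
    nra. }
assert (V := variation_bound nu M _ q a da b db _ A B FS HG HA
   (Hlim m_infty m l Hm Hl ltac:(ring))
   (Hlim p_infty p r Hp Hr ltac:(unfold k; field; lra)) HB' HB0).
exists (fun t => b t * A t + a t * B t), (fun t => db t * A t + da t * B t), k.
split.
- intros t. derive. ring.
- intros t. derive.
  transitivity (q t * (b t * A t + a t * B t) + (a t * db t - da t * b t) * (Q t + k * a t)); [ring|].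
  rewrite (fs_wronskian FS); ring.
- rewrite HB0, (fs_db0 FS); ring.
- eexists; exact V.
Qed.

(** * The perturbation as a fixed point problem *)

(** With [f z = mu * z + delta * z ^ 2 - z ^ 3], the perturbed field at
    [(U, V)] is [f (U + eta * V)] with the linear part
    [mu * eta * V] replaced by [eta * lambda * V].  For [U = u + x],
    [V = v + y] and [k = eta * lambda], this is
    [f u + (mu + 2 * delta * u - 3 * u ^ 2) * x + k * v + forcing]. *)
Definition forcing (delta eta u v x y k : R) : R :=
  k * y
  + delta * ((u + x + eta * (v + y)) ^ 2 - (u + x) ^ 2)
  - ((u + x + eta * (v + y)) ^ 3 - (u + x) ^ 3)
  + (delta - 3 * u) * x ^ 2 - x ^ 3.

Lemma Rabs_product_diff (x1 x2 y1 y2 X Y DX DY : R) :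
  Rabs x1 <= X -> Rabs y2 <= Y ->
  Rabs (x1 - x2) <= DX -> Rabs (y1 - y2) <= DY ->
  Rabs (x1 * y1 - x2 * y2) <= X * DY + DX * Y.
Proof.
intros. replace (x1 * y1 - x2 * y2) with (x1 * (y1 - y2) + (x1 - x2) * y2) by ring.
apply Rabs_plus_le; apply Rabs_mult_le; assumption.
Qed.

(** Every term of [forcing] that depends on [(x, y, k)] carries a factor [eta] or is
    at least quadratic in [(x, y, k)].  Hence the small Lipschitz constant
    [L * (eta + r)] for arguments of size [r]. *)
Lemma forcing_lipschitz (delta B : R) :
  0 <= delta -> 0 <= B ->
  exists L, 0 < L /\ forall eta r u v x1 y1 k1 x2 y2 k2 e w,
  0 <= eta <= 1 -> 0 <= r <= 1 -> 0 <= w <= 1 -> 0 <= e ->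
  Rabs u <= B -> Rabs v <= B ->
  Rabs x1 <= r * w -> Rabs y1 <= r * w -> Rabs k1 <= r ->
  Rabs x2 <= r * w -> Rabs y2 <= r * w -> Rabs k2 <= r ->
  Rabs (x1 - x2) <= e * w -> Rabs (y1 - y2) <= e * w -> Rabs (k1 - k2) <= e ->
  Rabs (forcing delta eta u v x1 y1 k1 - forcing delta eta u v x2 y2 k2)
    <= L * (eta + r) * e * w.
Proof.
intros Hd HB. pose (b := B + 1).
exists (5 + 6 * delta * b + 21 * b ^ 2 + 2 * (delta + 3 * B)).
assert (Hb : 1 <= b) by (unfold b; lra).
split; [assert (0 <= delta * b) by nra; nra|].
intros eta r u v x1 y1 k1 x2 y2 k2 e w He Hr Hw Hee Hu Hv Hx1 Hy1 Hk1 Hx2 Hy2 Hk2 Dx Dy Dk.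
pose (D := e * w). assert (HD : 0 <= D) by (unfold D; nra).
assert (Hrw : r * w <= r) by nra.
fold D in Dx, Dy.
assert (HX1 : Rabs (u + x1) <= b) by (eapply Rle_trans; [apply Rabs_plus_le; eassumption|unfold b; lra]).
assert (HX2 : Rabs (u + x2) <= b) by (eapply Rle_trans; [apply Rabs_plus_le; eassumption|unfold b; lra]).
assert (HY1 : Rabs (v + y1) <= b) by (eapply Rle_trans; [apply Rabs_plus_le; eassumption|unfold b; lra]).
assert (HY2 : Rabs (v + y2) <= b) by (eapply Rle_trans; [apply Rabs_plus_le; eassumption|unfold b; lra]).
assert (DX : Rabs ((u + x1) - (u + x2)) <= D) by (replace (u + x1 - (u + x2)) with (x1 - x2) by ring; exact Dx).
assert (DY : Rabs ((v + y1) - (v + y2)) <= D) by (replace (v + y1 - (v + y2)) with (y1 - y2) by ring; exact Dy).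
assert (P1 := Rabs_product_diff _ _ _ _ _ _ _ _ HX1 HY2 DX DY).
assert (P2 := Rabs_product_diff _ _ _ _ _ _ _ _ HY1 HY2 DY DY).
assert (P3 := Rabs_product_diff _ _ _ _ _ _ _ _ HX1 (Rabs_mult_le _ _ _ _ HX2 HY2) DX P1).
assert (P4 := Rabs_product_diff _ _ _ _ _ _ _ _ HX1 (Rabs_mult_le _ _ _ _ HY2 HY2) DX P2).
assert (P5 := Rabs_product_diff _ _ _ _ _ _ _ _ HY1 (Rabs_mult_le _ _ _ _ HY2 HY2) DY P2).
assert (Q1 := Rabs_product_diff _ _ _ _ _ _ _ _ Hk1 Hy2 Dk Dy).
assert (Hx1' : Rabs x1 <= r) by lra. assert (Hx2' : Rabs x2 <= r) by lra.
assert (Q2 := Rabs_product_diff _ _ _ _ _ _ _ _ Hx1' Hx2' Dx Dx).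
assert (Q3 := Rabs_product_diff _ _ _ _ _ _ _ _ Hx1' (Rabs_mult_le _ _ _ _ Hx2' Hx2') Dx Q2).
assert (HE1 : Rabs eta <= eta) by (rewrite Rabs_pos_eq; lra).
assert (He2 : eta ^ 2 <= eta) by nra.
assert (He3 : eta ^ 3 <= eta) by nra.
assert (HE2 : Rabs (eta ^ 2) <= eta) by (rewrite Rabs_pos_eq; nra).
assert (HE3 : Rabs (eta ^ 3) <= eta) by (rewrite Rabs_pos_eq; [lra|apply pow_le; lra]).
assert (HD3 : Rabs (delta - 3 * u) <= delta + 3 * B).
{ apply Rabs_minus_le; [rewrite Rabs_pos_eq; lra|].
  rewrite Rabs_mult, (Rabs_pos_eq 3) by lra. lra. }
assert (Hd' : Rabs delta <= delta) by (rewrite Rabs_pos_eq; lra).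
assert (H2 : Rabs 2 <= 2) by (rewrite Rabs_pos_eq; lra).
assert (H3 : Rabs 3 <= 3) by (rewrite Rabs_pos_eq; lra).
match goal with |- Rabs ?g <= _ => replace g with
  ((k1 * y1 - k2 * y2)
   + delta * (2 * (eta * ((u + x1) * (v + y1) - (u + x2) * (v + y2)))
              + eta ^ 2 * ((v + y1) * (v + y1) - (v + y2) * (v + y2)))
   - (3 * (eta * ((u + x1) * ((u + x1) * (v + y1)) - (u + x2) * ((u + x2) * (v + y2))))
      + 3 * (eta ^ 2 * ((u + x1) * ((v + y1) * (v + y1)) - (u + x2) * ((v + y2) * (v + y2))))
      + eta ^ 3 * ((v + y1) * ((v + y1) * (v + y1)) - (v + y2) * ((v + y2) * (v + y2))))
   + (delta - 3 * u) * (x1 * x1 - x2 * x2)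
   - (x1 * (x1 * x1) - x2 * (x2 * x2)))
  by (unfold forcing; ring) end.
eapply Rle_trans.
- repeat first [ eassumption | apply Rabs_minus_le | apply Rabs_plus_le | apply Rabs_mult_le ].
- replace (e * (r * w)) with (r * D) by (unfold D; ring).
  replace ((5 + 6 * delta * b + 21 * b ^ 2 + 2 * (delta + 3 * B)) * (eta + r) * e * w)
    with ((5 + 6 * delta * b + 21 * b ^ 2 + 2 * (delta + 3 * B)) * (eta * D + r * D)) by (unfold D; ring).
  assert (0 <= eta * D) by nra. assert (HrD : 0 <= r * D) by nra.
  assert (r * (r * D) <= r * D) by nra.
  assert (0 <= delta * b) by nra.
  assert (0 <= (5 + 2 * (delta + 3 * B)) * (eta * D)) by (apply Rmult_le_pos; lra).
  assert (0 <= (6 * (delta * b) + 21 * b ^ 2) * (r * D)) by (apply Rmult_le_pos; nra).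
  lra.
Qed.

(** The residual of the unperturbed loop, with its part of first order in [eta]. *)
Lemma forcing_zero (delta B : R) :
  0 <= delta -> 0 <= B ->
  exists E, 0 < E /\ forall eta u v w,
  0 <= eta <= 1 -> 0 <= w -> Rabs u <= B -> Rabs v <= B -> Rabs v <= B * w ->
  Rabs (forcing delta eta u v 0 0 0) <= E * eta * w /\
  Rabs (forcing delta eta u v 0 0 0 - eta * (2 * delta * u * v - 3 * u ^ 2 * v)) <= E * eta ^ 2 * w.
Proof.
intros Hd HB.
exists (1 + 3 * delta * B ^ 2 + 7 * B ^ 3).
assert (HB2 : 0 <= B ^ 2) by nra. assert (HB3 : 0 <= B ^ 3) by (apply pow_le; lra).
assert (HdB : 0 <= delta * B ^ 2) by (apply Rmult_le_pos; lra).
split; [nra|].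
intros eta u v w He Hw Hu Hv Hvw.
assert (HE1 : Rabs eta <= eta) by (rewrite Rabs_pos_eq; lra).
assert (He2 : eta ^ 2 <= eta) by nra.
assert (HE2 : Rabs (eta ^ 2) <= eta ^ 2) by (rewrite Rabs_pos_eq; nra).
assert (HE3 : Rabs (eta ^ 3) <= eta ^ 2) by (rewrite Rabs_pos_eq; [nra|apply pow_le; lra]).
assert (Hd' : Rabs delta <= delta) by (rewrite Rabs_pos_eq; lra).
assert (H2 : Rabs 2 <= 2) by (rewrite Rabs_pos_eq; lra).
assert (H3 : Rabs 3 <= 3) by (rewrite Rabs_pos_eq; lra).
(* part of first order in [eta], then the rest *)
assert (T1 : Rabs (eta * (delta * (2 * (u * v)) - 3 * (u * (u * v))))
  <= eta * (delta * (2 * (B * (B * w))) + 3 * (B * (B * (B * w))))).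
{ repeat first [ eassumption | apply Rabs_minus_le | apply Rabs_mult_le ]. }
assert (T2 : Rabs (delta * (eta ^ 2 * (v * v)) - 3 * (eta ^ 2 * (u * (v * v)))
    - eta ^ 3 * (v * (v * v)))
  <= delta * (eta ^ 2 * (B * (B * w))) + 3 * (eta ^ 2 * (B * (B * (B * w))))
     + eta ^ 2 * (B * (B * (B * w)))).
{ repeat first [ eassumption | apply Rabs_minus_le | apply Rabs_mult_le ]. }
assert (W1 : 0 <= eta * w) by nra.
assert (W2 : 0 <= eta ^ 2 * w) by nra.
assert (W12 : eta ^ 2 * w <= eta * w) by nra.
assert (N1 : 0 <= delta * B ^ 2 * (eta * w)) by (apply Rmult_le_pos; lra).
assert (N2 : 0 <= delta * B ^ 2 * (eta ^ 2 * w)) by (apply Rmult_le_pos; lra).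
assert (N3 : 0 <= B ^ 3 * (eta ^ 2 * w)) by (apply Rmult_le_pos; lra).
assert (N4 : delta * B ^ 2 * (eta ^ 2 * w) <= delta * B ^ 2 * (eta * w)) by (apply Rmult_le_compat_l; lra).
assert (N5 : B ^ 3 * (eta ^ 2 * w) <= B ^ 3 * (eta * w)) by (apply Rmult_le_compat_l; lra).
split.
- replace (forcing delta eta u v 0 0 0) with
   (eta * (delta * (2 * (u * v)) - 3 * (u * (u * v)))
    + (delta * (eta ^ 2 * (v * v)) - 3 * (eta ^ 2 * (u * (v * v))) - eta ^ 3 * (v * (v * v))))
   by (unfold forcing; ring).
  eapply Rle_trans; [apply Rabs_plus_le; eassumption|]. lra.
- match goal with |- Rabs ?g <= _ => replace g with
   (delta * (eta ^ 2 * (v * v)) - 3 * (eta ^ 2 * (u * (v * v))) - eta ^ 3 * (v * (v * v)))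
   by (unfold forcing; ring) end.
  eapply Rle_trans; [eassumption|]. lra.
Qed.

(** In the hypotheses, [r - l] is the integral of [v ^ 2] and [jr - jl] that of
    [v * (2 * delta * u * v - 3 * u ^ 2 * v)], so [lam] is the zero of the Melnikov
    integral. *)
Lemma loop_persistence (nu M mu delta lam : R) (u v dv b db S J : R -> R) (l r jl jr : R) :
  0 <= delta ->
  (forall t, is_derive u t (v t)) ->
  (forall t, dv t = mu * u t + delta * u t ^ 2 - u t ^ 3) ->
  (forall t, Rabs (u t) <= M) ->
  fundamental_system nu M (fun t => mu + 2 * delta * u t - 3 * u t ^ 2) v dv b db ->
  (forall t, is_derive S t (v t ^ 2)) -> is_lim S m_infty l -> is_lim S p_infty r -> 0 < r - l ->
  (forall t, is_derive J t (v t * (2 * delta * u t * v t - 3 * u t ^ 2 * v t))) ->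
  is_lim J m_infty jl -> is_lim J p_infty jr ->
  jr - jl + lam * (r - l) = 0 ->
  exists eta0 C, 0 < eta0 /\ 0 < C /\ forall eta, 0 < eta < eta0 ->
  exists (lambda : R) (U V : R -> R),
    Rabs (lambda - lam) <= C * eta /\ solution mu delta lambda eta U V /\
    forall t, Rabs (U t - u t) <= C * eta * weight nu t /\
              Rabs (V t - v t) <= C * eta * weight nu t.
Proof.
intros Hdelta Hu Hdv Hub FS HS Hl Hr Hrl HJ Hjl Hjr Hlam.
set (q := fun t => mu + 2 * delta * u t - 3 * u t ^ 2) in FS.
assert (Hnu := fs_nu FS). assert (HM := fs_M FS).
assert (Hv := fs_da FS).
assert (Hw : forall t, 0 <= weight nu t <= 1).
{ intros t. generalize (weight_pos nu t) (weight_le_1 nu t). lra. }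
assert (Hvw : forall t, Rabs (v t) <= M * weight nu t).
{ intros t. eapply Rle_trans; [apply (fs_a_bound FS)|].
  replace (2 * nu) with (nu + nu) by ring. rewrite <- weight_mult.
  specialize (Hw t). apply Rmult_le_compat_l; [lra|]. nra. }
assert (Hvb : forall t, Rabs (v t) <= M).
{ intros t. eapply Rle_trans; [apply Hvw|]. specialize (Hw t); nra. }
destruct (response_bound nu M q v dv b db S l r FS HS Hl Hr Hrl) as [C1 [HC1 Hresp]].
destruct (forcing_lipschitz delta M Hdelta) as [L [HL Hlip]]; [lra|].
destruct (forcing_zero delta M Hdelta) as [E [HE Hzero]]; [lra|].
(* responses have size at most [r1 * eta] *)
assert (Hr1' : exists r1, r1 = 2 * E * C1) by (eexists; reflexivity).
destruct Hr1' as [r1 Er1].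
assert (Hr1 : 0 < r1) by (rewrite Er1; nra).
assert (HLC : 0 < 2 * L * (1 + r1) * C1) by (apply Rmult_lt_0_compat; [apply Rmult_lt_0_compat|]; lra).
pose (C := r1 + C1 * (L * (1 + r1) * r1 + E)).
assert (HC : 0 <= C1 * (L * (1 + r1) * r1 + E)).
{ apply Rmult_le_pos; [lra|]. apply Rplus_le_le_0_compat; [|lra].
  apply Rmult_le_pos; [apply Rmult_le_pos|]; lra. }
(* the denominator makes [eta <= 1], [r1 * eta <= 1] and the contraction
   factor [L * (eta + r1 * eta) * C1 <= 1 / 2] *)
exists (/ (1 + r1 + 2 * L * (1 + r1) * C1)), C.
split; [apply Rinv_0_lt_compat; lra|]. split; [unfold C; lra|].
intros eta [He0 He].
assert (He' : eta * (1 + r1 + 2 * L * (1 + r1) * C1) < 1).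
{ apply (Rmult_lt_compat_r (1 + r1 + 2 * L * (1 + r1) * C1)) in He; [|lra].
  rewrite Rinv_l in He; lra. }
assert (Her1 : eta * r1 <= 1) by nra.
assert (He1 : eta <= 1) by nra.
assert (Hre : 0 <= r1 * eta) by nra.
assert (Hrw : forall t, 0 <= r1 * eta * weight nu t) by (intros t; apply Rmult_le_pos; [lra|apply Hw]).
assert (Hfac : L * (eta + r1 * eta) * C1 <= 1 / 2) by nra.
pose (rho := 2 * E * eta).
assert (Hrho : 0 < rho) by (unfold rho; nra).
(* [X], [Y], [K] below select a response for each admissible [Q] *)
assert (Hex : forall Q, exists p : (R -> R) * (R -> R) * R,
  admissible nu rho Q -> response nu q v Q (fst (fst p)) (snd (fst p)) (snd p)).
{ intros Q. destruct (excluded_middle_informative (admissible nu rho Q)) as [HQ|HQ].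
  - destruct (response_exists nu M q v dv b db S l r FS HS Hl Hr ltac:(lra) Q rho HQ)
      as [x [y [k R]]].
    exists (x, y, k); intros _; exact R.
  - exists (fun _ => 0, fun _ => 0, 0). intros; contradiction. }
pose (resp := fun Q => epsilon (inhabits (fun _ : R => 0, fun _ : R => 0, 0)) (fun p =>
  admissible nu rho Q -> response nu q v Q (fst (fst p)) (snd (fst p)) (snd p))).
pose (X := fun Q => fst (fst (resp Q))). pose (Y := fun Q => snd (fst (resp Q))).
pose (K := fun Q => snd (resp Q)).
assert (HR : forall Q, admissible nu rho Q -> response nu q v Q (X Q) (Y Q) (K Q)).
{ intros Q. unfold X, Y, K, resp.
  apply (epsilon_spec (inhabits (fun _ : R => 0, fun _ : R => 0, 0)) (fun p =>
    admissible nu rho Q -> response nu q v Q (fst (fst p)) (snd (fst p)) (snd p))), Hex. }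
clearbody X Y K; clear resp Hex.
assert (HRb : forall Q, admissible nu rho Q -> Rabs (K Q) <= r1 * eta /\
   forall t, Rabs (X Q t) <= r1 * eta * weight nu t /\ Rabs (Y Q t) <= r1 * eta * weight nu t).
{ intros Q HQ. replace (r1 * eta) with (C1 * rho) by (unfold rho; rewrite Er1; ring).
  exact (Hresp Q (X Q) (Y Q) (K Q) rho (HR Q HQ) (proj2 HQ)). }
pose (Phi := fun Q t => forcing delta eta (u t) (v t) (X Q t) (Y Q t) (K Q)).
assert (HPhi0 : forall Q t, admissible nu rho Q ->
  Rabs (Phi Q t - forcing delta eta (u t) (v t) 0 0 0)
    <= L * (eta + r1 * eta) * (r1 * eta) * weight nu t).
{ intros Q t HQ. destruct (HRb Q HQ) as [Kb Xb]. destruct (Xb t) as [Xt Yt].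
  specialize (Hrw t).
  apply Hlip; rewrite ?Rminus_0_r, ?Rabs_R0; auto; lra. }
destruct (weighted_contraction nu rho Phi) as [Q [HQ Hfix]]; [lra|lra| | |].
- intros Q HQ. destruct (HR Q HQ) as [Hx Hy _ _]. split.
  + intros t. eapply continuous_of_derive. unfold Phi, forcing. der.
  + intros t. specialize (HPhi0 Q t HQ).
    destruct (Hzero eta (u t) (v t) (weight nu t)) as [Z _]; auto; [lra|apply Hw|].
    replace (Phi Q t) with ((Phi Q t - forcing delta eta (u t) (v t) 0 0 0)
      + forcing delta eta (u t) (v t) 0 0 0) by ring.
    eapply Rle_trans; [apply Rabs_plus_le; eassumption|].
    replace (r1 * eta) with (C1 * rho) at 2 by (unfold rho; rewrite Er1; ring).
    replace (E * eta) with (1 / 2 * rho) by (unfold rho; field).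
    replace (L * (eta + r1 * eta) * (C1 * rho) * weight nu t)
      with (L * (eta + r1 * eta) * C1 * (rho * weight nu t)) by ring.
    assert (0 <= rho * weight nu t) by (specialize (Hw t); nra). nra.
- intros P Q e HP HQ HPQ t.
  assert (He'' : 0 <= e) by (generalize (bound_nonneg _ _ _ HPQ); auto).
  destruct (Hresp _ _ _ _ e (response_sub _ _ _ _ _ _ _ _ _ _ _ (HR P HP) (HR Q HQ)) HPQ)
    as [Dk Dxy].
  destruct (HRb P HP) as [KP XP]. destruct (HRb Q HQ) as [KQ XQ].
  destruct (XP t) as [XPt YPt]. destruct (XQ t) as [XQt YQt]. destruct (Dxy t) as [Dx Dy].
  unfold Phi. eapply Rle_trans.
  + apply (Hlip eta (r1 * eta)) with (e := C1 * e) (w := weight nu t); auto; try lra.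
    apply Rmult_le_pos; lra.
  + replace (L * (eta + r1 * eta) * (C1 * e) * weight nu t)
      with (L * (eta + r1 * eta) * C1 * (e * weight nu t)) by ring.
    assert (0 <= e * weight nu t) by (specialize (Hw t); nra). nra.
- destruct (HR Q HQ) as [Hx Hy _ _]. destruct (HRb Q HQ) as [Kb Xb].
  exists (K Q / eta), (fun t => u t + X Q t), (fun t => v t + Y Q t).
  split; [|split].
  + pose (Qm := fun t => eta * (2 * delta * u t * v t - 3 * u t ^ 2 * v t)).
    assert (Hadm : admissible nu (eta * (2 * delta * M * M + 3 * (M * M) * M)) Qm).
    { split.
      - intros t. eapply continuous_of_derive. unfold Qm. der.
      - intros t. unfold Qm.
        replace (eta * (2 * delta * u t * v t - 3 * u t ^ 2 * v t))
          with (eta * (2 * delta * u t * v t - 3 * (u t * u t) * v t)) by ring.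
        replace (eta * (2 * delta * M * M + 3 * (M * M) * M) * weight nu t)
          with (eta * (2 * delta * M * (M * weight nu t) + 3 * (M * M) * (M * weight nu t))) by ring.
        apply Rabs_mult_le; [rewrite Rabs_pos_eq; lra|].
        repeat first [ apply Hub | apply Hvw | apply Rabs_minus_le | apply Rabs_mult_le
          | rewrite Rabs_pos_eq; lra ]. }
    destruct (response_exists nu M q v dv b db S l r FS HS Hl Hr ltac:(lra) Qm _ Hadm)
      as [x [y [k R]]].
    (* [Qm] is the leading part of [Q]; its response has scalar [eta * lam], and
       [K Q - k] is controlled by [Q - Qm], which is of order [eta ^ 2] *)
    assert (Hk : k = eta * lam).
    { assert (SV := response_solvability nu M q v dv b db Qm x y S (fun t => eta * J t) k l r
        (eta * jl) (eta * jr) FS R HS Hl Hr).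
      assert (eta * jr - eta * jl + k * (r - l) = 0).
      { apply SV.
        - intros t; unfold Qm; derive; ring.
        - apply (is_lim_scal_l J eta _ jl), Hjl.
        - apply (is_lim_scal_l J eta _ jr), Hjr. }
      apply (Rmult_eq_reg_r (r - l)); [|lra]. nra. }
    assert (HQm : forall t, Rabs (Q t - Qm t) <= (L * (1 + r1) * r1 + E) * eta ^ 2 * weight nu t).
    { intros t. rewrite <- Hfix. specialize (HPhi0 Q t HQ).
      destruct (Hzero eta (u t) (v t) (weight nu t)) as [_ Z]; auto; [lra|apply Hw|].
      replace (Phi Q t - Qm t) with ((Phi Q t - forcing delta eta (u t) (v t) 0 0 0)
        + (forcing delta eta (u t) (v t) 0 0 0 - Qm t)) by ring.
      eapply Rle_trans; [apply Rabs_plus_le; eassumption|]. right; ring. }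
    destruct (Hresp _ _ _ _ _ (response_sub _ _ _ _ _ _ _ _ _ _ _ (HR Q HQ) R) HQm) as [Dk _].
    rewrite Hk in Dk.
    replace (K Q / eta - lam) with ((K Q - eta * lam) / eta) by (field; lra).
    unfold Rdiv. rewrite Rabs_mult, (Rabs_pos_eq (/ eta)) by (left; apply Rinv_0_lt_compat, He0).
    apply (Rmult_le_reg_r eta); [exact He0|]. rewrite Rmult_assoc, Rinv_l, Rmult_1_r by lra.
    eapply Rle_trans; [exact Dk|]. unfold C.
    assert (0 <= r1 * (eta * eta)) by (apply Rmult_le_pos; nra).
    lra.
  + intros t; unfold field_u, field_v. split; [der|].
    derive. rewrite Hdv, <- Hfix. unfold Phi, forcing, q. field. lra.
  + intros t. destruct (Xb t) as [Xt Yt].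
    replace (u t + X Q t - u t) with (X Q t) by ring.
    replace (v t + Y Q t - v t) with (Y Q t) by ring.
    assert (r1 * eta * weight nu t <= C * eta * weight nu t).
    { specialize (Hw t). apply Rmult_le_compat_r; [lra|]. unfold C. nra. }
    lra.
Qed.

(** * Exponential orders and hyperbolic functions *)

(** Decay at least at rate [k] or, for negative [k], growth at most at rate [- k].
    Orders add under multiplication. *)
Definition order (k : R) (f : R -> R) : Prop :=
  exists M, forall t, Rabs (f t) <= M * weight k t.

Lemma order_const (c : R) : order 0 (fun _ => c).
Proof.
exists (Rabs c); intros t; unfold weight. rewrite Ropp_0, Rmult_0_l, exp_0. lra.
Qed.
Lemma order_weaken (j k : R) (f : R -> R) : j <= k -> order k f -> order j f.
Proof.
intros Hjk [M HM]; exists M; intros t. eapply Rle_trans; [apply HM|].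
assert (0 <= M) by exact (bound_nonneg _ _ _ HM).
replace k with (j + (k - j)) by ring. rewrite <- weight_mult.
generalize (weight_le_1 (k - j) t ltac:(lra)) (weight_pos j t) (weight_pos (k - j) t); intros.
apply Rmult_le_compat_l; [lra|]. nra.
Qed.
Lemma order_mult (j k : R) (f g : R -> R) :
  order j f -> order k g -> order (j + k) (fun t => f t * g t).
Proof.
intros [M HM] [N HN]; exists (M * N); intros t. rewrite <- weight_mult.
replace (M * N * (weight j t * weight k t)) with (M * weight j t * (N * weight k t)) by ring.
apply Rabs_mult_le; auto.
Qed.
Lemma order_plus (k : R) (f g : R -> R) :
  order k f -> order k g -> order k (fun t => f t + g t).
Proof.
intros [M HM] [N HN]; exists (M + N); intros t. rewrite Rmult_plus_distr_r.
apply Rabs_plus_le; auto.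
Qed.
Lemma order_minus (k : R) (f g : R -> R) :
  order k f -> order k g -> order k (fun t => f t - g t).
Proof.
intros [M HM] [N HN]; exists (M + N); intros t. rewrite Rmult_plus_distr_r.
apply Rabs_minus_le; auto.
Qed.
Lemma order_pow (k : R) (f : R -> R) (n : nat) : order k f -> order (INR n * k) (fun t => f t ^ n).
Proof.
intros Hf; induction n as [|n IH].
- simpl INR; rewrite Rmult_0_l; apply (order_const 1).
- rewrite S_INR. replace ((INR n + 1) * k) with (k + INR n * k) by ring.
  simpl pow. now apply order_mult.
Qed.
Lemma order_lim (k : R) (f : R -> R) :
  0 < k -> order k f -> is_lim f m_infty 0 /\ is_lim f p_infty 0.
Proof.
intros Hk [M HM]; split; apply (is_lim_dominated f _ _ HM).
- now apply is_lim_scal_zero, weight_lim_m.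
- now apply is_lim_scal_zero, weight_lim_p.
Qed.

Lemma cosh_sinh_sqr x : sinh x ^ 2 = cosh x ^ 2 - 1.
Proof.
unfold sinh, cosh. assert (H : exp x * exp (- x) = 1) by (rewrite <- exp_plus, Rplus_opp_r; apply exp_0).
nra.
Qed.
Lemma cosh_abs x : cosh (Rabs x) = cosh x.
Proof.
unfold Rabs; destruct (Rcase_abs x); auto. unfold cosh; rewrite Ropp_involutive; lra.
Qed.
Lemma cosh_bounds x : exp (Rabs x) / 2 <= cosh x <= exp (Rabs x).
Proof.
rewrite <- cosh_abs. unfold cosh. generalize (exp_pos (- Rabs x)). intros.
assert (exp (- Rabs x) <= exp (Rabs x)).
{ destruct (Req_dec x 0) as [->|Hx]; [rewrite Rabs_R0, Ropp_0; lra|].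
  left; apply exp_increasing. generalize (Rabs_pos_lt x Hx); lra. }
lra.
Qed.
Lemma cosh_ge_1 x : 1 <= cosh x.
Proof.
generalize (cosh_sinh_sqr x) (cosh_bounds x) (exp_pos (Rabs x)). intros.
generalize (pow2_ge_0 (sinh x)); nra.
Qed.
Lemma sinh_abs_le x : Rabs (sinh x) <= cosh x.
Proof.
generalize (cosh_sinh_sqr x) (cosh_ge_1 x). intros.
apply Rabs_le; split; nra.
Qed.
Lemma order_cosh (om : R) : 0 < om -> order (- om) (fun t => cosh (om * t)).
Proof.
intros Hom; exists 1; intros t.
rewrite Rabs_pos_eq by (generalize (cosh_ge_1 (om * t)); lra).
unfold weight. rewrite Ropp_involutive, Rmult_1_l.
replace (om * Rabs t) with (Rabs (om * t)) by (rewrite Rabs_mult, (Rabs_pos_eq om); lra).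
apply cosh_bounds.
Qed.
Lemma order_sinh (om : R) : 0 < om -> order (- om) (fun t => sinh (om * t)).
Proof.
intros Hom. destruct (order_cosh om Hom) as [M HM]. exists M; intros t.
eapply Rle_trans; [|apply HM].
eapply Rle_trans; [apply sinh_abs_le|apply Rle_abs].
Qed.
Lemma order_linear (om : R) : 0 < om -> order (- om) (fun t => om * t).
Proof.
intros Hom. exists 1; intros t.
unfold weight. rewrite Ropp_involutive, Rmult_1_l, Rabs_mult, (Rabs_pos_eq om) by lra.
generalize (exp_ineq1_le (om * Rabs t)); lra.
Qed.

(** * The two loops *)

(** [K] has either sign: positive for one loop, negative for the other. *)
Record loop_data (mu delta om c K : R) : Prop := {
  ld_om : 0 < om;
  ld_mu : mu = om ^ 2;
  ld_delta : delta = 3 * om ^ 2 * c;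
  ld_K : 2 * om ^ 2 * (K ^ 2 - c ^ 2) = 1 }.
Arguments ld_om {mu delta om c K} _.
Arguments ld_mu {mu delta om c K} _.
Arguments ld_delta {mu delta om c K} _.
Arguments ld_K {mu delta om c K} _.

Definition loop_u (om c K t : R) : R := / (K * cosh (om * t) - c).
Definition loop_v (om c K t : R) : R := - (K * om * sinh (om * t)) * loop_u om c K t ^ 2.

(** For this reason [K * cosh (om * t) - c] never vanishes, and its modulus is at least
    a multiple of [cosh (om * t)]. *)
Lemma loop_gap {mu delta om c K} : loop_data mu delta om c K -> Rabs c < Rabs K.
Proof.
intros H. assert (Hom := ld_om H). assert (HK := ld_K H).
apply Rsqr_lt_abs_0. unfold Rsqr. assert (0 < om ^ 2) by (apply pow_lt; lra).
apply Rnot_le_lt; intros E.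
assert (0 <= om ^ 2 * (c ^ 2 - K ^ 2)) by (apply Rmult_le_pos; lra). lra.
Qed.

Lemma loop_w_lower {mu delta om c K} t : loop_data mu delta om c K ->
  (Rabs K - Rabs c) * cosh (om * t) <= Rabs (K * cosh (om * t) - c).
Proof.
intros H. assert (G := loop_gap H). assert (C := cosh_ge_1 (om * t)).
generalize (Rabs_triang_inv (K * cosh (om * t)) c).
rewrite Rabs_mult, (Rabs_pos_eq (cosh (om * t))) by lra.
generalize (Rabs_pos c); nra.
Qed.

Lemma loop_w_neq0 {mu delta om c K} t : loop_data mu delta om c K -> K * cosh (om * t) - c <> 0.
Proof.
intros H E. assert (L := loop_w_lower t H). rewrite E, Rabs_R0 in L.
generalize (loop_gap H) (cosh_ge_1 (om * t)). nra.
Qed.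

Lemma loop_K_neq0 {mu delta om c K} : loop_data mu delta om c K -> K <> 0.
Proof. intros H ->. generalize (loop_gap H) (Rabs_pos c). rewrite Rabs_R0; lra. Qed.

Lemma loop_u_w {mu delta om c K} t : loop_data mu delta om c K ->
  loop_u om c K t * (K * cosh (om * t) - c) = 1.
Proof. intros H; unfold loop_u; apply Rinv_l, (loop_w_neq0 t H). Qed.

Lemma der_loop_u {mu delta om c K} t : loop_data mu delta om c K ->
  is_derive (loop_u om c K) t (loop_v om c K t).
Proof.
intros H. unfold loop_v, loop_u. assert (W := loop_w_neq0 t H).
eapply der_val; [der; exact W|]. field; exact W.
Qed.

Definition nonlinearity (mu delta x : R) : R := mu * x + delta * x ^ 2 - x ^ 3.

(** The cubic term comes from [2 * om ^ 2 * (K ^ 2 - c ^ 2) = 1], after clearing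
    the denominators by [u * (K * cosh (om * t) - c) = 1]. *)
Lemma der_loop_v {mu delta om c K} t : loop_data mu delta om c K ->
  is_derive (loop_v om c K) t (nonlinearity mu delta (loop_u om c K t)).
Proof.
intros H. assert (Hu := fun t => der_loop_u t H).
unfold loop_v at 1. eapply der_val; [der|]. cbv beta; simpl INR; simpl pred.
unfold loop_v, nonlinearity. assert (E := loop_u_w t H).
assert (S2 := cosh_sinh_sqr (om * t)).
rewrite (ld_mu H), (ld_delta H).
set (U := loop_u om c K t) in *. set (C := cosh (om * t)) in *. set (S := sinh (om * t)) in *.
assert (HK := ld_K H).
transitivity (om ^ 2 * U ^ 3 * (- K * C * (K * C - c) + 2 * K ^ 2 * S ^ 2)
  + om ^ 2 * K * C * U ^ 2 * (U * (K * C - c) - 1)); [ring|].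
rewrite E, S2.
transitivity (om ^ 2 * U * (U * (K * C - c)) ^ 2 + 3 * om ^ 2 * c * U ^ 2 * (U * (K * C - c))
  - 2 * om ^ 2 * (K ^ 2 - c ^ 2) * U ^ 3); [ring|].
rewrite E, HK; ring.
Qed.

Lemma order_loop_u {mu delta om c K} : loop_data mu delta om c K -> order om (loop_u om c K).
Proof.
intros H. assert (Hom := ld_om H). assert (G := loop_gap H).
exists (2 / (Rabs K - Rabs c)); intros t. unfold loop_u.
rewrite Rabs_inv. assert (L := loop_w_lower t H).
assert (B := proj1 (cosh_bounds (om * t))).
rewrite Rabs_mult, (Rabs_pos_eq om) in B by lra.
unfold weight. replace (- om * Rabs t) with (- (om * Rabs t)) by ring. rewrite exp_Ropp.
assert (EP := exp_pos (om * Rabs t)).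
replace (2 / (Rabs K - Rabs c) * / exp (om * Rabs t))
  with (/ ((Rabs K - Rabs c) * (exp (om * Rabs t) / 2))) by (field; split; lra).
apply Rinv_le_contravar; [apply Rmult_lt_0_compat; lra|].
eapply Rle_trans; [|exact L]. apply Rmult_le_compat_l; lra.
Qed.

Lemma order_loop_v {mu delta om c K} : loop_data mu delta om c K -> order om (loop_v om c K).
Proof.
intros H. assert (Hom := ld_om H). unfold loop_v.
replace om with (- om + INR 2 * om) at 1 by (simpl; ring).
apply order_mult; [|apply order_pow, (order_loop_u H)].
destruct (order_mult 0 (- om) (fun _ => - (K * om)) _ (order_const _) (order_sinh om Hom)) as [M HM].
exists M; intros t. rewrite <- (Rplus_0_l (- om)).
replace (- (K * om * sinh (om * t))) with (- (K * om) * sinh (om * t)) by ring. apply HM.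
Qed.

(** * The second solution of the variational equation *)

(** By reduction of order, a second solution is [a] times a primitive of [/ a ^ 2],
    with [a = loop_v].  As [/ a ^ 2] is a multiple of
    [(K * cosh - c) ^ 4 / sinh ^ 2], the primitive is elementary; the only term that
    is not a polynomial in [cosh] and [sinh], after multiplication by [sinh], is
    [om * t * sinh (om * t)].  [sol2_num] is [sinh] times this primitive. *)
Definition sol2_num (om c K t : R) : R :=
  - (K ^ 4 + 6 * K ^ 2 * c ^ 2 + c ^ 4) * cosh (om * t) + 4 * K * c * (K ^ 2 + c ^ 2)
  + (3 / 2 * K ^ 4 + 6 * K ^ 2 * c ^ 2) * ((om * t) * sinh (om * t))
  - 4 * K ^ 3 * c * sinh (om * t) ^ 2
  + K ^ 4 / 2 * (sinh (om * t) ^ 2 * cosh (om * t)).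

(** [om * sol2_dnum] is the derivative of [sol2_num]. *)
Definition sol2_dnum (om c K t : R) : R :=
  - (K ^ 4 + 6 * K ^ 2 * c ^ 2 + c ^ 4) * sinh (om * t)
  + (3 / 2 * K ^ 4 + 6 * K ^ 2 * c ^ 2) * sinh (om * t)
  + (3 / 2 * K ^ 4 + 6 * K ^ 2 * c ^ 2) * ((om * t) * cosh (om * t))
  - 8 * K ^ 3 * c * (sinh (om * t) * cosh (om * t))
  + K ^ 4 * (sinh (om * t) * cosh (om * t) ^ 2) + K ^ 4 / 2 * sinh (om * t) ^ 3.
Definition sol2 (om c K t : R) : R :=
  - / (K * om ^ 2) * (sol2_num om c K t * loop_u om c K t ^ 2).
Definition dsol2 (om c K t : R) : R :=
  - / (K * om) * (sol2_dnum om c K t * loop_u om c K t ^ 2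
     - 2 * K * (sol2_num om c K t * (sinh (om * t) * loop_u om c K t ^ 3))).

Lemma der_sol2 {mu delta om c K} t : loop_data mu delta om c K ->
  is_derive (sol2 om c K) t (dsol2 om c K t).
Proof.
intros H. assert (Hu := fun t => der_loop_u t H).
assert (Hom := ld_om H). assert (HK := loop_K_neq0 H).
unfold sol2 at 1, sol2_num at 1. eapply der_val; [der|]. cbv beta; simpl INR; simpl pred.
unfold dsol2, sol2_num, sol2_dnum, loop_v. field. split; [lra|exact HK].
Qed.

Lemma der_dsol2 {mu delta om c K} t : loop_data mu delta om c K ->
  is_derive (dsol2 om c K) t
    ((mu + 2 * delta * loop_u om c K t - 3 * loop_u om c K t ^ 2) * sol2 om c K t).
Proof.
intros H. assert (Hu := fun t => der_loop_u t H).
assert (Hom := ld_om H). assert (HK := loop_K_neq0 H).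
unfold dsol2 at 1, sol2_num at 1, sol2_dnum at 1.
eapply der_val; [der|]. cbv beta; simpl INR; simpl pred.
rewrite (ld_mu H), (ld_delta H).
replace (3 * loop_u om c K t ^ 2) with (6 * om ^ 2 * (K ^ 2 - c ^ 2) * loop_u om c K t ^ 2)
  by (transitivity (3 * (2 * om ^ 2 * (K ^ 2 - c ^ 2)) * loop_u om c K t ^ 2);
      [ring|rewrite (ld_K H); ring]).
unfold sol2, sol2_num, sol2_dnum, loop_v, loop_u.
assert (W := loop_w_neq0 t H).
unfold sinh, cosh in *. rewrite exp_Ropp in *.
(* in terms of [E = exp (om * t)] this is an identity of rational functions *)
assert (EP := exp_pos (om * t)). set (E := exp (om * t)) in *. clearbody E.
field. repeat split; try lra; try exact HK.
- intros Z. apply W. apply (Rmult_eq_reg_r (2 * E)); [|lra]. rewrite Rmult_0_l, <- Z. field. lra.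
Qed.

Lemma sol2_wronskian {mu delta om c K} t : loop_data mu delta om c K ->
  loop_v om c K t * dsol2 om c K t - nonlinearity mu delta (loop_u om c K t) * sol2 om c K t = 1.
Proof.
intros H.
assert (Hom := ld_om H). assert (HK := loop_K_neq0 H).
unfold nonlinearity.
rewrite (ld_mu H), (ld_delta H).
replace (loop_u om c K t ^ 3) with (2 * om ^ 2 * (K ^ 2 - c ^ 2) * loop_u om c K t ^ 3)
  by (rewrite (ld_K H); ring).
unfold dsol2, sol2, sol2_num, sol2_dnum, loop_v, loop_u.
assert (W := loop_w_neq0 t H).
unfold sinh, cosh in *. rewrite exp_Ropp in *.
(* in terms of [E = exp (om * t)] this is an identity of rational functions *)
assert (EP := exp_pos (om * t)). set (E := exp (om * t)) in *. clearbody E.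
field. repeat split; try lra; try exact HK.
intros Z. apply W. apply (Rmult_eq_reg_r (2 * E)); [|lra]. rewrite Rmult_0_l, <- Z. field. lra.
Qed.

Ltac order_product :=
  cbv beta;
  first
  [ match goal with |- order _ (fun _ => ?c) => apply (order_const c) end
  | match goal with
    | H : order _ ?f |- order _ ?f => exact H
    | H : order _ ?f |- order _ (fun t => ?f t) => exact H
    end
  | lazymatch goal with
    | |- order _ (fun t => @?f t * @?g t) => eapply (order_mult _ _ f g); order_product
    | |- order _ (fun t => (@?f t) ^ ?n) => eapply (order_pow _ f n); order_product
    end ].
Ltac order_sum :=
  lazymatch goal with
  | |- order _ (fun t => @?f t + @?g t) => apply (order_plus _ f g); order_sum
  | |- order _ (fun t => @?f t - @?g t) => apply (order_minus _ f g); order_sum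
  | |- _ => eapply order_weaken; [|order_product]; simpl INR; lra
  end.

Lemma order_sol2 {mu delta om c K} : loop_data mu delta om c K ->
  order (- om) (sol2 om c K) /\ order (- om) (dsol2 om c K).
Proof.
intros H. assert (Hom := ld_om H).
assert (OC := order_cosh om Hom). assert (OS := order_sinh om Hom).
assert (OT := order_linear om Hom). assert (OU := order_loop_u H).
assert (ON : order (- (3 * om)) (sol2_num om c K)) by (unfold sol2_num; order_sum).
assert (OD : order (- (3 * om)) (sol2_dnum om c K)) by (unfold sol2_dnum; order_sum).
split.
- unfold sol2. order_sum.
- unfold dsol2. replace (- om) with (0 + - om) by ring.
  apply order_mult; [apply order_const|]. order_sum.
Qed.

Lemma loop_fundamental_system {mu delta om c K} : loop_data mu delta om c K ->
  exists M, (forall t, Rabs (loop_u om c K t) <= M) /\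
  fundamental_system (om / 2) M (fun t => mu + 2 * delta * loop_u om c K t - 3 * loop_u om c K t ^ 2)
    (loop_v om c K) (fun t => nonlinearity mu delta (loop_u om c K t)) (sol2 om c K) (dsol2 om c K).
Proof.
intros H. assert (Hom := ld_om H).
assert (Hu := fun t => der_loop_u t H).
assert (OU := order_loop_u H). assert (OV := order_loop_v H).
destruct (order_sol2 H) as [OB ODB].
assert (ODV : order om (fun t => nonlinearity mu delta (loop_u om c K t)))
  by (unfold nonlinearity; order_sum).
assert (OU0 : order 0 (loop_u om c K)) by (eapply order_weaken; [|exact OU]; lra).
destruct OU0 as [M1 H1]. destruct OV as [M2 H2]. destruct ODV as [M3 H3].
destruct OB as [M4 H4]. destruct ODB as [M5 H5].
assert (N1 := bound_nonneg _ _ _ H1). assert (N2 := bound_nonneg _ _ _ H2).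
assert (N3 := bound_nonneg _ _ _ H3). assert (N4 := bound_nonneg _ _ _ H4).
assert (N5 := bound_nonneg _ _ _ H5).
assert (HM : forall f k m, (forall t, Rabs (f t) <= m * weight k t) ->
   m <= 1 + M1 + M2 + M3 + M4 + M5 ->
   forall t, Rabs (f t) <= (1 + M1 + M2 + M3 + M4 + M5) * weight k t).
{ intros f k m Hf Hm t. eapply Rle_trans; [apply Hf|].
  apply Rmult_le_compat_r; [left; apply weight_pos|exact Hm]. }
exists (1 + M1 + M2 + M3 + M4 + M5). split.
- intros t. replace (1 + M1 + M2 + M3 + M4 + M5) with ((1 + M1 + M2 + M3 + M4 + M5) * weight 0 t)
    by (unfold weight; rewrite Ropp_0, Rmult_0_l, exp_0; ring).
  apply (HM _ 0 M1); [exact H1|lra].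
- split; replace (2 * (om / 2)) with om by field; try lra.
  + intros t; apply (der_loop_v t H).
  + intros t. unfold nonlinearity. derive. ring.
  + intros t; apply (der_sol2 t H).
  + intros t; apply (der_dsol2 t H).
  + intros t; apply (sol2_wronskian t H).
  + unfold dsol2, sol2_dnum. rewrite Rmult_0_r, sinh_0. ring.
  + apply (HM _ _ M2); [exact H2|lra].
  + apply (HM _ _ M3); [exact H3|lra].
  + apply (HM _ _ M4); [exact H4|lra].
  + apply (HM _ _ M5); [exact H5|lra].
Qed.

(** * Moments of the loops *)

(** This is [tanh (om * t / 2)]. *)
Definition half_tanh (om t : R) : R := sinh (om * t) / (1 + cosh (om * t)).

Lemma half_tanh_lim om : 0 < om ->
  is_lim (half_tanh om) m_infty (- 1) /\ is_lim (half_tanh om) p_infty 1.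
Proof.
intros Hom.
assert (P : is_lim (half_tanh om) p_infty 1).
{ apply (is_lim_ext (fun t => (1 - exp (- om * t)) / (1 + exp (- om * t)))).
  - intros t. unfold half_tanh, sinh, cosh. replace (- om * t) with (- (om * t)) by ring.
    rewrite exp_Ropp. assert (EP := exp_pos (om * t)).
    field. repeat split; nra.
  - assert (E := is_lim_exp_neg om Hom).
    evar_last.
    + apply is_lim_div; [apply is_lim_minus'; [apply is_lim_const|exact E]
        |apply is_lim_plus'; [apply is_lim_const|exact E]| |].
      * intros Z; injection Z; lra.
      * exact I || (simpl; lra).
    + simpl. f_equal. field. }
split; [|exact P].
apply (is_lim_ext (fun t => - half_tanh om (- t))).
- intros t; unfold half_tanh. rewrite Ropp_mult_distr_r_reverse.
  unfold sinh, cosh. rewrite Ropp_involutive. field.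
  generalize (exp_pos (om * t)) (exp_pos (- (om * t))); lra.
- apply (is_lim_opp (fun t => half_tanh om (- t)) m_infty 1). apply is_lim_reflect_p, P.
Qed.

Definition loop_angle (om c K t : R) : R :=
  2 * sqrt 2 * atan (sqrt 2 * om * (K + c) * half_tanh om t).

Lemma sqrt2_sqr : sqrt 2 ^ 2 = 2.
Proof. rewrite pow2_sqrt; lra. Qed.

(** With [th = sqrt 2 * om * (K + c)], the relation
    [1 = 2 * om ^ 2 * (K ^ 2 - c ^ 2)] gives
    [1 + cosh + th ^ 2 * (cosh - 1) = 4 * om ^ 2 * (K + c) * (K * cosh - c)], which
    turns the derivative of the arctangent into [u]. *)
Lemma der_loop_angle {mu delta om c K} t : loop_data mu delta om c K ->
  is_derive (loop_angle om c K) t (loop_u om c K t).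
Proof.
intros H. assert (Hom := ld_om H). assert (HK := ld_K H).
assert (W := loop_w_neq0 t H). assert (C1 := cosh_ge_1 (om * t)).
assert (S2 := cosh_sinh_sqr (om * t)). assert (Q2 := sqrt2_sqr).
unfold loop_angle.
assert (D : is_derive (fun t => sqrt 2 * om * (K + c) * half_tanh om t) t
   (sqrt 2 * om ^ 2 * (K + c) / (1 + cosh (om * t)))).
{ unfold half_tanh. eapply der_val; [der; lra|]. cbv beta.
  apply (Rmult_eq_reg_r ((1 + cosh (om * t)) ^ 2)); [|apply pow_nonzero; lra].
  transitivity (sqrt 2 * om ^ 2 * (K + c) * (cosh (om * t) + cosh (om * t) ^ 2 - sinh (om * t) ^ 2));
    [field; lra|rewrite S2; field; lra]. }
eapply der_val.
- apply der_mult; [apply der_const|]. apply (der_comp atan); [exact D|].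
  apply is_derive_Reals, derivable_pt_lim_atan.
- cbv beta. unfold loop_u, half_tanh.
  set (C := cosh (om * t)) in *. set (S := sinh (om * t)) in *.
  set (D2 := (1 + C) ^ 2 + sqrt 2 ^ 2 * om ^ 2 * (K + c) ^ 2 * S ^ 2).
  assert (P : 0 < D2).
  { assert (0 <= sqrt 2 ^ 2 * om ^ 2 * (K + c) ^ 2 * S ^ 2)
      by (repeat first [apply pow2_ge_0 | apply Rmult_le_pos]).
    unfold D2; nra. }
  transitivity (2 * (sqrt 2 ^ 2 * om ^ 2 * (K + c)) * (1 + C) / D2).
  + unfold D2. field. fold D2. split; [|lra].
    replace (_ + _) with D2 by (unfold D2; ring). lra.
  + apply (Rmult_eq_reg_r ((K * C - c) * D2));
      [|apply Rmult_integral_contrapositive; split; [exact W|lra]].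
    transitivity (2 * (sqrt 2 ^ 2 * om ^ 2 * (K + c)) * (1 + C) * (K * C - c)); [field; lra|].
    transitivity D2; [|field; exact W].
    unfold D2. rewrite S2, Q2.
    transitivity ((1 + C) ^ 2 * (2 * om ^ 2 * (K ^ 2 - c ^ 2)) + 2 * om ^ 2 * (K + c) ^ 2 * (C ^ 2 - 1));
      [ring|rewrite HK; ring].
Qed.

Lemma loop_angle_lim om c K : 0 < om ->
  is_lim (loop_angle om c K) m_infty (- (2 * sqrt 2 * atan (sqrt 2 * om * (K + c)))) /\
  is_lim (loop_angle om c K) p_infty (2 * sqrt 2 * atan (sqrt 2 * om * (K + c))).
Proof.
intros Hom. destruct (half_tanh_lim om Hom) as [Lm Lp].
assert (G : forall (z : Rbar) (s : R), is_lim (half_tanh om) z s ->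
  is_lim (loop_angle om c K) z (2 * sqrt 2 * atan (sqrt 2 * om * (K + c) * s))).
{ intros z s L. unfold loop_angle.
  apply (is_lim_scal_l _ (2 * sqrt 2) z (atan (sqrt 2 * om * (K + c) * s))).
  apply (filterlim_comp _ _ _ (fun t => sqrt 2 * om * (K + c) * half_tanh om t) atan _
    (locally (sqrt 2 * om * (K + c) * s))).
  - apply (is_lim_scal_l _ (sqrt 2 * om * (K + c)) z s L).
  - apply (continuous_of_derive atan _ (/ (1 + (sqrt 2 * om * (K + c) * s) ^ 2))).
    apply is_derive_Reals, derivable_pt_lim_atan. }
split.
- evar_last; [apply G, Lm|]. f_equal.
  replace (sqrt 2 * om * (K + c) * -1) with (- (sqrt 2 * om * (K + c))) by ring.
  rewrite atan_opp. ring.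
- evar_last; [apply G, Lp|]. f_equal. now rewrite Rmult_1_r.
Qed.

(** The quotient [v / u]. *)
Definition log_slope (om c K t : R) : R := - (K * om) * sinh (om * t) * loop_u om c K t.

Lemma loop_v_log_slope om c K t : loop_v om c K t = log_slope om c K t * loop_u om c K t.
Proof. unfold loop_v, log_slope; ring. Qed.

(** This is the equation [H = 0] divided by [u ^ 2 / 2]. *)
Lemma log_slope_sqr {mu delta om c K} t : loop_data mu delta om c K ->
  log_slope om c K t ^ 2 =
  mu + 2 * delta / 3 * loop_u om c K t - 1 / 2 * loop_u om c K t ^ 2.
Proof.
intros H. assert (E := loop_u_w t H).
rewrite (ld_mu H), (ld_delta H). unfold log_slope.
assert (S2 := cosh_sinh_sqr (om * t)). assert (HK := ld_K H).
set (U := loop_u om c K t) in *. set (C := cosh (om * t)) in *. set (S := sinh (om * t)) in *.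
transitivity (om ^ 2 * K ^ 2 * U ^ 2 * S ^ 2); [ring|]. rewrite S2.
transitivity (om ^ 2 * (U * (K * C - c)) ^ 2 + 2 * om ^ 2 * c * U * (U * (K * C - c))
  - 1 / 2 * (2 * om ^ 2 * (K ^ 2 - c ^ 2)) * U ^ 2); [field|]. rewrite E, HK. field.
Qed.

Lemma der_log_slope {mu delta om c K} t : loop_data mu delta om c K ->
  is_derive (log_slope om c K) t (delta / 3 * loop_u om c K t - 1 / 2 * loop_u om c K t ^ 2).
Proof.
intros H. assert (Hu := fun t => der_loop_u t H).
assert (W := loop_w_neq0 t H).
assert (L2 := log_slope_sqr t H).
unfold log_slope at 1. eapply der_val; [der|]. cbv beta.
rewrite loop_v_log_slope.
transitivity (- (K * om ^ 2) * cosh (om * t) * loop_u om c K t + log_slope om c K t ^ 2).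
{ unfold log_slope at 2. unfold log_slope. ring. }
rewrite L2, (ld_mu H), (ld_delta H).
assert (E := loop_u_w t H).
set (U := loop_u om c K t) in *. set (C := cosh (om * t)) in *.
transitivity (- om ^ 2 * (U * (K * C - c)) - om ^ 2 * c * U + (om ^ 2 + 2 * (3 * om ^ 2 * c) / 3 * U - 1 / 2 * U ^ 2));
 [ring|rewrite E; field].
Qed.

(** The slope approaches the eigenvalues of the saddle: [om] along the unstable
    direction and [- om] along the stable one. *)
Lemma log_slope_lim {mu delta om c K} : loop_data mu delta om c K ->
  is_lim (log_slope om c K) m_infty om /\ is_lim (log_slope om c K) p_infty (- om).
Proof.
intros H. assert (Hom := ld_om H).
destruct (half_tanh_lim om Hom) as [Lm Lp].
assert (OS := order_sinh om Hom). assert (OU := order_loop_u H).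
(* the function in [OD] is [log_slope + om * half_tanh] *)
assert (OI : order om (fun t => / (1 + cosh (om * t)))).
{ exists 2; intros t. assert (B := proj1 (cosh_bounds (om * t))).
  rewrite Rabs_mult, (Rabs_pos_eq om) in B by lra. assert (EP := exp_pos (om * Rabs t)).
  rewrite Rabs_pos_eq by (left; apply Rinv_0_lt_compat; lra).
  unfold weight. replace (- om * Rabs t) with (- (om * Rabs t)) by ring. rewrite exp_Ropp.
  replace (2 * / exp (om * Rabs t)) with (/ (exp (om * Rabs t) / 2)) by (field; lra).
  apply Rinv_le_contravar; lra. }
assert (OD : order om (fun t => - om * (K + c) * (sinh (om * t) * (loop_u om c K t * / (1 + cosh (om * t)))))).
{ eapply order_weaken; [|apply order_mult; [apply order_const|apply order_mult; [exact OS|apply order_mult; [exact OU|exact OI]]]]. lra. }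
destruct (order_lim om _ Hom OD) as [Dm Dp].
assert (G : forall (z : Rbar) (s : R), is_lim (half_tanh om) z s ->
  is_lim (fun t => - om * (K + c) * (sinh (om * t) * (loop_u om c K t * / (1 + cosh (om * t))))) z 0 ->
  is_lim (log_slope om c K) z (0 - om * s)).
{ intros z s L D.
  apply (is_lim_ext (fun t => - om * (K + c) * (sinh (om * t) * (loop_u om c K t * / (1 + cosh (om * t))))
     - om * half_tanh om t)).
  - intros t. unfold half_tanh, log_slope, loop_u.
    assert (W := loop_w_neq0 t H). assert (C1 := cosh_ge_1 (om * t)).
    field. split; [exact W|lra].
  - apply is_lim_minus'; [exact D|]. apply (is_lim_scal_l _ om z s L). }
split.
- evar_last; [apply (G _ _ Lm Dm)|f_equal; ring].
- evar_last; [apply (G _ _ Lp Dp)|f_equal; ring].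
Qed.

(** The primitive of [a * u] plus a polynomial multiple of [v / u].  At infinity
    [p0] alone survives among the coefficients of the polynomial, since [u] tends
    to 0. *)
Definition loop_primitive (om c K a p0 p1 p2 p3 p4 t : R) : R :=
  a * loop_angle om c K t + log_slope om c K t *
   (p0 + p1 * loop_u om c K t + p2 * loop_u om c K t ^ 2 + p3 * loop_u om c K t ^ 3
    + p4 * loop_u om c K t ^ 4).

Lemma der_loop_primitive mu delta om c K a p0 p1 p2 p3 p4 t : loop_data mu delta om c K ->
  let u := loop_u om c K t in
  is_derive (loop_primitive om c K a p0 p1 p2 p3 p4) t
   (a * u + p0 * (delta / 3 * u - 1 / 2 * u ^ 2)
    + p1 * (mu * u + delta * u ^ 2 - u ^ 3)
    + p2 * (2 * mu * u ^ 2 + 5 * delta / 3 * u ^ 3 - 3 / 2 * u ^ 4)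
    + p3 * (3 * mu * u ^ 3 + 7 * delta / 3 * u ^ 4 - 2 * u ^ 5)
    + p4 * (4 * mu * u ^ 4 + 3 * delta * u ^ 5 - 5 / 2 * u ^ 6)).
Proof.
intros H u. assert (Hu := fun t => der_loop_u t H).
assert (HL := fun t => der_log_slope t H).
assert (HA := fun t => der_loop_angle t H).
unfold loop_primitive. eapply der_val; [der|]. cbv beta; simpl INR; simpl pred.
rewrite loop_v_log_slope. fold u.
assert (L2 := log_slope_sqr t H). fold u in L2.
set (l := log_slope om c K t) in *.
transitivity (a * u + (delta / 3 * u - 1 / 2 * u ^ 2) * (p0 + p1 * u + p2 * u ^ 2 + p3 * u ^ 3 + p4 * u ^ 4)
  + l ^ 2 * (p1 * u + 2 * p2 * u ^ 2 + 3 * p3 * u ^ 3 + 4 * p4 * u ^ 4)); [ring|].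
rewrite L2. field.
Qed.

Lemma loop_primitive_lim mu delta om c K a p0 p1 p2 p3 p4 : loop_data mu delta om c K ->
  is_lim (loop_primitive om c K a p0 p1 p2 p3 p4) m_infty
    (- (a * (2 * sqrt 2 * atan (sqrt 2 * om * (K + c))) - om * p0)) /\
  is_lim (loop_primitive om c K a p0 p1 p2 p3 p4) p_infty
    (a * (2 * sqrt 2 * atan (sqrt 2 * om * (K + c))) - om * p0).
Proof.
intros H. assert (Hom := ld_om H).
destruct (loop_angle_lim om c K Hom) as [Am Ap].
destruct (log_slope_lim H) as [Lm Lp].
destruct (order_lim om _ Hom (order_loop_u H)) as [Um Up].
assert (G : forall (z : Rbar) (x l : R), is_lim (loop_angle om c K) z x ->
  is_lim (log_slope om c K) z l -> is_lim (loop_u om c K) z 0 ->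
  is_lim (loop_primitive om c K a p0 p1 p2 p3 p4) z (a * x + l * p0)).
{ intros z x l HA HL HU.
  assert (P : forall n p, is_lim (fun t => p * loop_u om c K t ^ S n) z 0)
    by (intros; now apply is_lim_scal_zero, is_lim_pow_zero).
  unfold loop_primitive. apply is_lim_plus'.
  - apply is_lim_mult_finite; [apply is_lim_const|exact HA].
  - apply is_lim_mult_finite; [exact HL|]. evar_last.
    + repeat apply is_lim_plus';
        [apply is_lim_const | now apply is_lim_scal_zero
        |apply (P 1%nat)|apply (P 2%nat)|apply (P 3%nat)].
    + f_equal; ring. }
split.
- evar_last; [apply (G _ _ _ Am Lm Um)|f_equal; ring].
- evar_last; [apply (G _ _ _ Ap Lp Up)|f_equal; ring].
Qed.

Lemma improper_integral (F f : R -> R) (l r : R) :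
  (forall t, is_derive F t (f t)) -> (forall t, continuous f t) ->
  is_lim F m_infty l -> is_lim F p_infty r ->
  is_RInt_gen f (Rbar_locally m_infty) (Rbar_locally p_infty) (r - l).
Proof.
intros HF Hf Hl Hr.
apply (is_RInt_gen_ext (Derive F)).
- apply filter_forall. intros [x y] t _. apply is_derive_unique, HF.
- apply is_RInt_gen_Derive.
  + apply filter_forall. intros [x y] t _. eexists; apply HF.
  + apply filter_forall. intros [x y] t _.
    apply (continuous_ext f); [|apply Hf]. intros s; symmetry; apply is_derive_unique, HF.
  + exact Hl.
  + exact Hr.
Qed.

(** The moment [u ^ k * v ^ 2] is
    [mu * u ^ (k + 2) + 2 * delta / 3 * u ^ (k + 3) - u ^ (k + 4) / 2]; eliminating its
    powers of [u] from the top degree down by the derivatives of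
    [l * u ^ n], [n = k + 2, ..., 0], with [l = log_slope], leaves a multiple of [u].
    [angle_coef] is the factor of that remainder, and [slope_coef] the multiple of
    [l] itself. *)
Definition angle_coef (mu delta : R) (k : nat) : R :=
  match k with
  | 0%nat => delta * (2 * delta ^ 2 + 9 * mu) / 27
  | 1%nat => (27 * mu + 10 * delta ^ 2) / 108 * mu
             + 2 * delta / 3 * (delta * (39 * mu + 10 * delta ^ 2) / 108)
  | _ => mu * (delta * (261 * mu + 70 * delta ^ 2) / 810)
         + 2 * delta / 3 * ((216 * mu ^ 2 + 345 * mu * delta ^ 2 + 70 * delta ^ 4) / 810)
  end.
Definition slope_coef (mu delta : R) (k : nat) : R :=
  match k with
  | 0%nat => - (2 / 9 * (3 * mu + delta ^ 2))
  | 1%nat => - (delta * (39 * mu + 10 * delta ^ 2) / 54)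
  | _ => - ((216 * mu ^ 2 + 345 * mu * delta ^ 2 + 70 * delta ^ 4) / 405)
  end.
Definition moment_primitive (mu delta om c K : R) (k : nat) : R -> R :=
  let P := loop_primitive om c K (angle_coef mu delta k) (slope_coef mu delta k) in
  match k with
  | 0%nat => P (- delta / 9) (1 / 3) 0 0
  | 1%nat => P (- (27 * mu + 10 * delta ^ 2) / 108) (- delta / 18) (1 / 4) 0
  | _ => P (- delta * (261 * mu + 70 * delta ^ 2) / 810)
           (- (18 * mu + 7 * delta ^ 2) / 135) (- delta / 30) (1 / 5)
  end.

Lemma der_moment_primitive mu delta om c K k t : loop_data mu delta om c K -> (k <= 2)%nat ->
  is_derive (moment_primitive mu delta om c K k) t (loop_u om c K t ^ k * loop_v om c K t ^ 2).
Proof.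
intros H Hk. rewrite loop_v_log_slope.
assert (L2 := log_slope_sqr t H).
replace ((log_slope om c K t * loop_u om c K t) ^ 2)
  with (log_slope om c K t ^ 2 * loop_u om c K t ^ 2) by ring.
rewrite L2.
destruct k as [|[|[|k]]]; [| | |lia]; unfold moment_primitive;
 (eapply der_val; [apply (der_loop_primitive mu delta), H|]);
 unfold angle_coef, slope_coef; set (u := loop_u om c K t); field.
Qed.

Lemma moment_integral mu delta om c K k : loop_data mu delta om c K -> (k <= 2)%nat ->
  exists l r : R,
   is_lim (moment_primitive mu delta om c K k) m_infty l /\
   is_lim (moment_primitive mu delta om c K k) p_infty r /\
   r - l = 4 * sqrt 2 * angle_coef mu delta k * atan (sqrt 2 * om * (K + c))
           - 2 * om * slope_coef mu delta k /\
   is_RInt_gen (fun t => loop_u om c K t ^ k * loop_v om c K t ^ 2)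
     (Rbar_locally m_infty) (Rbar_locally p_infty) (r - l).
Proof.
intros H Hk.
set (V := angle_coef mu delta k * (2 * sqrt 2 * atan (sqrt 2 * om * (K + c)))
   - om * slope_coef mu delta k).
assert (L : is_lim (moment_primitive mu delta om c K k) m_infty (- V) /\
            is_lim (moment_primitive mu delta om c K k) p_infty V).
{ destruct k as [|[|[|k]]]; [| | |lia]; apply (loop_primitive_lim mu delta), H. }
exists (- V), V. split; [apply L|]. split; [apply L|]. split; [unfold V; ring|].
apply (improper_integral (moment_primitive mu delta om c K k)); [| |apply L|apply L].
- intros t; apply der_moment_primitive; assumption.
- intros t. assert (Hu := fun t => der_loop_u t H).
  assert (Hv := fun t => der_loop_v t H).
  eapply continuous_of_derive. der.
Qed.

(** The primitive of [v ^ 2] is nondecreasing, and it is not constant on [0, 1]. *)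
Lemma zeroth_moment_pos mu delta om c K (l r : R) : loop_data mu delta om c K ->
  is_lim (moment_primitive mu delta om c K 0) m_infty l ->
  is_lim (moment_primitive mu delta om c K 0) p_infty r -> 0 < r - l.
Proof.
intros H Hl Hr. assert (Hom := ld_om H). assert (HK := loop_K_neq0 H).
set (F := moment_primitive mu delta om c K 0) in *.
assert (D : forall t, is_derive F t (loop_v om c K t ^ 2)).
{ intros t. eapply der_val; [apply der_moment_primitive; [exact H|lia]|ring]. }
assert (Mono : forall s t, s <= t -> F s <= F t).
{ intros s t Hst. assert (- F t <= - F s); [|lra].
  apply (nonincreasing_of_derive (fun t => - F t) (fun t => - loop_v om c K t ^ 2) s t Hst).
  - intros x. derive. ring.
  - intros x _. generalize (pow2_ge_0 (loop_v om c K x)); lra. }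
assert (A : l <= F 0).
{ apply (is_lim_le_loc F (fun _ => F 0) m_infty l (F 0)); [|exact Hl|apply is_lim_const].
  exists 0; intros t Ht; apply Mono; lra. }
assert (B : F 1 <= r).
{ apply (is_lim_le_loc (fun _ => F 1) F p_infty (F 1) r); [|apply is_lim_const|exact Hr].
  exists 1; intros t Ht; apply Mono; lra. }
assert (C : F 0 < F 1).
{ assert (E := Mono 0 1 ltac:(lra)). apply Rnot_le_lt. intros E'.
  (* otherwise F is constant on [0, 1], so v vanishes at 1/2 *)
  assert (Z : is_derive F (1 / 2) 0).
  { apply (is_derive_ext_loc (fun _ => F 0)); [|apply der_const].
    exists (mkposreal (1 / 2) ltac:(lra)). intros y Hy.
    change (Rabs (y - 1 / 2) < 1 / 2) in Hy. apply Rabs_def2 in Hy.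
    generalize (Mono 0 y ltac:(lra)) (Mono y 1 ltac:(lra)); lra. }
  assert (V0 : loop_v om c K (1 / 2) ^ 2 = 0).
  { rewrite <- (is_derive_unique _ _ _ (D (1 / 2))). apply is_derive_unique, Z. }
  assert (S1 : 0 < sinh (om * (1 / 2))) by (rewrite <- sinh_0; apply sinh_lt; lra).
  revert V0. apply pow_nonzero. unfold loop_v, loop_u.
  assert (W := loop_w_neq0 (1 / 2) H).
  apply Rmult_integral_contrapositive; split.
  - apply Ropp_neq_0_compat. apply Rmult_integral_contrapositive; split; [|lra].
    apply Rmult_integral_contrapositive; split; [exact HK|lra].
  - apply pow_nonzero, Rinv_neq_0_compat, W. }
lra.
Qed.

(** * The loops in their original parameters *)

Definition loop_K (s : loop_sign) (mu delta : R) : R :=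
  pm s * sqrt (2 * delta ^ 2 + 9 * mu) / (3 * sqrt 2 * mu).
Definition loop_c (mu delta : R) : R := delta / (3 * mu).

Lemma sqrt2_pos : 0 < sqrt 2.
Proof. apply sqrt_lt_R0; lra. Qed.
Lemma radicand_pos mu delta : 0 < mu -> 0 < 2 * delta ^ 2 + 9 * mu.
Proof. intros; generalize (pow2_ge_0 delta); lra. Qed.
Lemma pm_sqr s : pm s ^ 2 = 1.
Proof. destruct s; simpl; ring. Qed.

Lemma loop_K_sqr s mu delta : 0 < mu ->
  loop_K s mu delta ^ 2 = (2 * delta ^ 2 + 9 * mu) / (18 * mu ^ 2).
Proof.
intros Hmu. assert (R := radicand_pos mu delta Hmu). assert (Q := sqrt2_pos).
unfold loop_K.
transitivity (pm s ^ 2 * sqrt (2 * delta ^ 2 + 9 * mu) ^ 2 / (9 * sqrt 2 ^ 2 * mu ^ 2));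
  [field; split; lra|].
rewrite pm_sqr, sqrt2_sqr, pow2_sqrt by lra. field; lra.
Qed.

Lemma loop_data_of s mu delta : 0 < mu ->
  loop_data mu delta (sqrt mu) (loop_c mu delta) (loop_K s mu delta).
Proof.
intros Hmu. assert (E : sqrt mu ^ 2 = mu) by (apply pow2_sqrt; lra). split.
- apply sqrt_lt_R0, Hmu.
- now rewrite E.
- rewrite E; unfold loop_c; field; lra.
- rewrite E, loop_K_sqr by exact Hmu. unfold loop_c. field; lra.
Qed.

(** [D] is the denominator of [u0] divided by
    [alpha0 = sqrt mu / sqrt (2 * delta ^ 2 + 9 * mu)]; dividing removes the quotient
    of radicals that would otherwise occur in both formulas. *)
Lemma u0_v0_denominator s mu delta t : 0 < mu ->
  exists D, D <> 0 /\
  sqrt 2 * delta * alpha0 mu delta - pm s * sqrt mu * cosh (sqrt mu * t)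
    = sqrt mu / sqrt (2 * delta ^ 2 + 9 * mu) * D /\
  loop_u (sqrt mu) (loop_c mu delta) (loop_K s mu delta) t = - (3 * sqrt 2 * mu) / D.
Proof.
intros Hmu. assert (W := loop_w_neq0 t (loop_data_of s mu delta Hmu)).
assert (P := radicand_pos mu delta Hmu). assert (Q := sqrt2_pos).
assert (PR := sqrt_lt_R0 _ P). assert (Pm := sqrt_lt_R0 _ Hmu).
set (D := sqrt 2 * delta - pm s * sqrt (2 * delta ^ 2 + 9 * mu) * cosh (sqrt mu * t)).
assert (E : loop_K s mu delta * cosh (sqrt mu * t) - loop_c mu delta = - D / (3 * sqrt 2 * mu)).
{ unfold loop_K, loop_c, D. field. lra. }
assert (HD : D <> 0).
{ intros Z. apply W. rewrite E, Z. field. lra. }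
exists D. split; [exact HD|split].
- unfold alpha0. rewrite sqrt_div by lra. unfold D. field. lra.
- unfold loop_u. rewrite E. field. repeat split; lra || exact HD.
Qed.

Lemma u0_loop s mu delta t : 0 < mu ->
  u0 s mu delta t = loop_u (sqrt mu) (loop_c mu delta) (loop_K s mu delta) t.
Proof.
intros Hmu. destruct (u0_v0_denominator s mu delta t Hmu) as [D [HD [E1 E2]]].
assert (P := radicand_pos mu delta Hmu). assert (Q := sqrt2_pos).
assert (PR := sqrt_lt_R0 _ P). assert (Pm := sqrt_lt_R0 _ Hmu).
unfold u0. rewrite E1, E2. unfold alpha0. rewrite sqrt_div by lra.
field. repeat split; lra || exact HD.
Qed.

Lemma v0_loop s mu delta t : 0 < mu ->
  v0 s mu delta t = loop_v (sqrt mu) (loop_c mu delta) (loop_K s mu delta) t.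
Proof.
intros Hmu. destruct (u0_v0_denominator s mu delta t Hmu) as [D [HD [E1 E2]]].
assert (P := radicand_pos mu delta Hmu). assert (Q := sqrt2_pos).
assert (PR := sqrt_lt_R0 _ P). assert (Pm := sqrt_lt_R0 _ Hmu).
assert (E : sqrt mu ^ 2 = mu) by (apply pow2_sqrt; lra).
unfold v0, loop_v. rewrite E1, E2. unfold alpha0, loop_K. rewrite sqrt_div by lra.
transitivity (- pm s * 3 * sqrt 2 * mu ^ 2 * sinh (sqrt mu * t) * sqrt (2 * delta ^ 2 + 9 * mu)
  / (sqrt mu * D ^ 2)); [field; repeat split; lra || exact HD|].
set (r := sqrt (2 * delta ^ 2 + 9 * mu)) in *. set (om := sqrt mu) in *.
clearbody r om. rewrite <- E. field. repeat split; lra || exact HD.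
Qed.

(** * Homoclinic solutions of the unperturbed system *)

(** Gronwall's inequality in both time directions: [f * exp (- k * t)] is
    nonincreasing and [f * exp (k * t)] is nondecreasing. *)
Lemma vanishing_of_linear_bound (f df : R -> R) (k t1 : R) :
  (forall t, is_derive f t (df t)) -> (forall t, 0 <= f t) ->
  (forall t, Rabs (df t) <= k * f t) -> f t1 = 0 -> forall t, f t = 0.
Proof.
intros Hd Hf Hb H1 t. apply Rle_antisym; [|apply Hf].
destruct (Rle_dec t1 t) as [Ht|Ht].
- assert (E : f t * exp (- k * t) <= f t1 * exp (- k * t1)).
  { apply (nonincreasing_of_derive (fun s => f s * exp (- k * s))
      (fun s => (df s - k * f s) * exp (- k * s)) t1 t); [lra| |].
    - intros x. derive. ring.
    - intros x _. generalize (exp_pos (- k * x)) (Hb x) (Rle_abs (df x)). nra. }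
  rewrite H1 in E. generalize (exp_pos (- k * t)). nra.
- assert (E : - (f t1 * exp (k * t1)) <= - (f t * exp (k * t))).
  { apply (nonincreasing_of_derive (fun s => - (f s * exp (k * s)))
      (fun s => - ((df s + k * f s) * exp (k * s))) t t1); [lra| |].
    - intros x. derive. ring.
    - intros x _. generalize (exp_pos (k * x)) (Hb x) (Rle_abs (- df x)).
      rewrite Rabs_Ropp. nra. }
  rewrite H1 in E. generalize (exp_pos (k * t)). nra.
Qed.

(** [Y + om * X] and [Y - om * X] solve first order equations. *)
Lemma zero_initial_data (om : R) (X Y : R -> R) :
  (forall t, is_derive X t (Y t)) -> (forall t, is_derive Y t (om ^ 2 * X t)) -> 0 < om ->
  X 0 = 0 -> Y 0 = 0 -> forall t, X t = 0 /\ Y t = 0.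
Proof.
intros HX HY Hom X0 Y0 t.
assert (A : (Y t + om * X t) * exp (- om * t) = (Y 0 + om * X 0) * exp (- om * 0)).
{ apply (constant_of_derive (fun t => (Y t + om * X t) * exp (- om * t))).
  intros s. derive. ring. }
assert (B : (Y t - om * X t) * exp (om * t) = (Y 0 - om * X 0) * exp (om * 0)).
{ apply (constant_of_derive (fun t => (Y t - om * X t) * exp (om * t))).
  intros s. derive. ring. }
rewrite X0, Y0, Rmult_0_r, Rplus_0_r, Rmult_0_l in A.
rewrite X0, Y0, Rmult_0_r, Rminus_0_r, Rmult_0_l in B.
apply Rmult_integral in A. apply Rmult_integral in B.
generalize (exp_pos (- om * t)) (exp_pos (om * t)); intros.
assert (Y t + om * X t = 0) by (destruct A; lra).
assert (Y t - om * X t = 0) by (destruct B; lra).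
split; [|lra]. apply (Rmult_eq_reg_l om); lra.
Qed.

Lemma unperturbed_field mu delta lambda x y :
  field_v mu delta lambda 0 x y = nonlinearity mu delta x.
Proof. unfold field_v, nonlinearity; ring. Qed.

Lemma homoclinic_energy mu delta lambda u v :
  homoclinic_solution mu delta lambda 0 u v -> forall t, Hfun mu delta (u t) (v t) = 0.
Proof.
intros [Hs [_ [_ [_ [Hu Hv]]]]] t.
assert (HU : forall t, is_derive u t (v t)) by (intros; apply Hs).
assert (HV : forall t, is_derive v t (nonlinearity mu delta (u t)))
  by (intros s; rewrite <- (unperturbed_field mu delta lambda _ (v s)); apply Hs).
assert (D : forall t, is_derive (fun t => Hfun mu delta (u t) (v t)) t 0).
{ intros s. unfold Hfun. derive. unfold nonlinearity. field. }
assert (L : is_lim (fun t => Hfun mu delta (u t) (v t)) p_infty (0 - 0 - 0 + 0)).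
{ unfold Hfun. apply is_lim_plus'; [apply is_lim_minus'; [apply is_lim_minus'|]|].
  all: apply is_lim_scal_zero; now apply (is_lim_pow_zero _ _ p_infty). }
rewrite (limit_of_constant _ _ _ D L t). ring.
Qed.

(** On [H = 0] one has [v ^ 2 <= (mu + 2 * delta ^ 2 / 9) * u ^ 2], so [u ^ 2]
    satisfies a linear differential inequality; a zero of [u] would force the
    solution to rest at the origin. *)
Lemma homoclinic_nonvanishing mu delta lambda u v : 0 < mu ->
  homoclinic_solution mu delta lambda 0 u v -> forall t, u t <> 0.
Proof.
intros Hmu HH t1 H1. assert (HE := homoclinic_energy _ _ _ _ _ HH).
destruct HH as [Hs [[t2 Ht2] _]].
assert (HU : forall t, is_derive u t (v t)) by (intros; apply Hs).
assert (B : forall t, v t ^ 2 <= (mu + 2 * delta ^ 2 / 9) * u t ^ 2).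
{ intros t. specialize (HE t). unfold Hfun in HE.
  assert (0 <= u t ^ 2 * (u t - 2 * delta / 3) ^ 2) by (apply Rmult_le_pos; apply pow2_ge_0).
  nra. }
assert (Z : forall t, u t ^ 2 = 0).
{ apply (vanishing_of_linear_bound (fun t => u t ^ 2) (fun t => 2 * u t * v t)
    (1 + (mu + 2 * delta ^ 2 / 9)) t1).
  - intros t. derive. ring.
  - intros t; apply pow2_ge_0.
  - intros t. specialize (B t).
    generalize (pow2_ge_0 (u t + v t)) (pow2_ge_0 (u t - v t)).
    intros; apply Rabs_le; split; lra.
  - rewrite H1; ring. }
apply Ht2. specialize (Z t2). specialize (B t2). rewrite Z in B.
assert (Zu : u t2 = 0) by nra. assert (Zv : v t2 = 0) by nra.
now rewrite Zu, Zv.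
Qed.

Lemma cosh_add x y : cosh (x + y) = cosh x * cosh y + sinh x * sinh y.
Proof. unfold cosh, sinh. rewrite Ropp_plus_distr, !exp_plus. field. Qed.
Lemma sinh_add x y : sinh (x + y) = sinh x * cosh y + cosh x * sinh y.
Proof. unfold cosh, sinh. rewrite Ropp_plus_distr, !exp_plus. field. Qed.

(** [W = 1 / u + c] satisfies [W'' = om ^ 2 * W], and [H = 0] at time 0 reads
    [W' ^ 2 = om ^ 2 * (W ^ 2 - K ^ 2)].  So [W] does not vanish at time 0, its sign there selects
    the loop, and [W = K * cosh (om * (t + t0))] with [t0] given by [arcsinh]. *)
Lemma homoclinic_classification mu delta lambda u v : 0 < mu ->
  homoclinic_solution mu delta lambda 0 u v ->
  exists s t0, forall t, u t = u0 s mu delta (t + t0) /\ v t = v0 s mu delta (t + t0).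
Proof.
intros Hmu HH.
assert (HE := homoclinic_energy _ _ _ _ _ HH).
assert (HN := homoclinic_nonvanishing _ _ _ _ _ Hmu HH).
destruct HH as [Hs _].
assert (HU : forall t, is_derive u t (v t)) by (intros; apply Hs).
assert (HV : forall t, is_derive v t (nonlinearity mu delta (u t)))
  by (intros s; rewrite <- (unperturbed_field mu delta lambda _ (v s)); apply Hs).
set (om := sqrt mu). set (c := loop_c mu delta).
assert (Hom : 0 < om) by apply (sqrt_lt_R0 _ Hmu).
assert (E : om ^ 2 = mu) by (apply pow2_sqrt; lra).
pose (W := fun t => / u t + c). pose (W' := fun t => - v t / u t ^ 2).
assert (HW : forall t, is_derive W t (W' t)).
{ intros t; unfold W, W'. eapply der_val; [der; apply HN|]. field. apply HN. }
assert (HW' : forall t, is_derive W' t (om ^ 2 * W t)).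
{ intros t; unfold W'. eapply der_val; [der; apply pow_nonzero, HN|].
  cbv beta; simpl INR; simpl pred.
  transitivity (- nonlinearity mu delta (u t) / u t ^ 2
     + 4 * (Hfun mu delta (u t) (v t) + mu / 2 * u t ^ 2 + delta / 3 * u t ^ 3 - 1 / 4 * u t ^ 4) / u t ^ 3).
  - unfold Hfun, nonlinearity. field. apply HN.
  - rewrite HE, E. unfold nonlinearity, W, c, loop_c. field. split; lra || apply HN. }
assert (HWW : W' 0 ^ 2 = mu * W 0 ^ 2 - (2 * delta ^ 2 + 9 * mu) / (18 * mu)).
{ unfold W'. transitivity (2 * (Hfun mu delta (u 0) (v 0) + mu / 2 * u 0 ^ 2 + delta / 3 * u 0 ^ 3
     - 1 / 4 * u 0 ^ 4) / u 0 ^ 4).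
  - unfold Hfun. field. apply HN.
  - rewrite HE. unfold W, c, loop_c. field. split; lra || apply HN. }
assert (P := radicand_pos mu delta Hmu).
assert (Hsign : exists s, 0 < W 0 * pm s).
{ assert (HD : 0 < (2 * delta ^ 2 + 9 * mu) / (18 * mu)) by (apply Rdiv_lt_0_compat; lra).
  destruct (Rtotal_order (W 0) 0) as [L|[Z|G]].
  - exists Lower; simpl; lra.
  - rewrite Z in HWW. generalize (pow2_ge_0 (W' 0)). nra.
  - exists Upper; simpl; lra. }
destruct Hsign as [s Hsign]. exists s.
assert (Hpm : pm s <> 0) by (destruct s; simpl; lra).
assert (LD := loop_data_of s mu delta Hmu). fold om c in LD.
set (K := loop_K s mu delta) in *.
assert (HK0 := loop_K_neq0 LD).
assert (HK2 : K ^ 2 = (2 * delta ^ 2 + 9 * mu) / (18 * mu ^ 2)) by apply (loop_K_sqr s mu delta Hmu).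
assert (HKs : 0 < K * pm s).
{ unfold K, loop_K. assert (Q := sqrt2_pos).
  replace (pm s * sqrt (2 * delta ^ 2 + 9 * mu) / (3 * sqrt 2 * mu) * pm s)
    with (pm s ^ 2 * (sqrt (2 * delta ^ 2 + 9 * mu) / (3 * sqrt 2 * mu))) by (field; lra).
  rewrite pm_sqr, Rmult_1_l. apply Rdiv_lt_0_compat; [apply sqrt_lt_R0, P|].
  apply Rmult_lt_0_compat; lra. }
pose (x0 := arcsinh (W' 0 / (K * om))). exists (x0 / om).
assert (Hsh : K * sinh x0 = W' 0 / om).
{ unfold x0. rewrite sinh_arcsinh. field. repeat split; lra || exact HK0. }
assert (Hch : K * cosh x0 = W 0).
{ assert (Hr : 0 < W 0 / K).
  { replace (W 0 / K) with (W 0 * pm s / (K * pm s)) by (field; repeat split; exact HK0 || exact Hpm).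
    apply Rdiv_lt_0_compat; assumption. }
  assert (Hq : cosh x0 ^ 2 = (W 0 / K) ^ 2).
  { assert (S2 := cosh_sinh_sqr x0).
    replace (cosh x0 ^ 2) with (1 + sinh x0 ^ 2) by lra.
    replace (sinh x0) with (W' 0 / (K * om)) by (unfold x0; rewrite sinh_arcsinh; reflexivity).
    transitivity ((K ^ 2 * om ^ 2 + W' 0 ^ 2) / (K ^ 2 * om ^ 2));
      [field; repeat split; lra || exact HK0|].
    rewrite HWW, E.
    transitivity ((K ^ 2 * mu + (mu * W 0 ^ 2 - (2 * delta ^ 2 + 9 * mu) / (18 * mu ^ 2) * mu)) / (K ^ 2 * mu));
      [field; repeat split; lra || exact HK0|].
    rewrite <- HK2. field. repeat split; lra || exact HK0. }
  assert (C1 := cosh_ge_1 x0).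
  assert (cosh x0 = W 0 / K) by nra.
  rewrite H. field. exact HK0. }
assert (Free := zero_initial_data om
  (fun t => W t - (W 0 * cosh (om * t) + W' 0 / om * sinh (om * t)))
  (fun t => W' t - (W 0 * om * sinh (om * t) + W' 0 * cosh (om * t)))).
assert (HWt : forall t, W t = K * cosh (om * (t + x0 / om)) /\
                        W' t = K * om * sinh (om * (t + x0 / om))).
{ intros t. destruct (Free) with (t := t) as [F1 F2]; auto.
  - intros r. derive. field. lra.
  - intros r. derive. field. lra.
  - rewrite Rmult_0_r, cosh_0, sinh_0. ring.
  - rewrite Rmult_0_r, cosh_0, sinh_0. ring.
  - replace (om * (t + x0 / om)) with (om * t + x0) by (field; lra).
    rewrite cosh_add, sinh_add. split.
    + replace (K * (cosh (om * t) * cosh x0 + sinh (om * t) * sinh x0))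
        with (K * cosh x0 * cosh (om * t) + K * sinh x0 * sinh (om * t)) by ring.
      rewrite Hch, Hsh. lra.
    + replace (K * om * (sinh (om * t) * cosh x0 + cosh (om * t) * sinh x0))
        with (K * cosh x0 * om * sinh (om * t) + om * (K * sinh x0) * cosh (om * t)) by ring.
      rewrite Hch, Hsh.
      replace (om * (W' 0 / om)) with (W' 0) by (field; lra). lra. }
intros t. rewrite u0_loop, v0_loop by exact Hmu. fold om c K.
destruct (HWt t) as [H1 H2].
assert (Hu : u t = loop_u om c K (t + x0 / om)).
{ unfold loop_u. rewrite <- H1. unfold W.
  replace (/ u t + c - c) with (/ u t) by ring. now rewrite Rinv_inv. }
split; [exact Hu|].
unfold loop_v. rewrite <- Hu, <- H2. unfold W'. field. apply HN.
Qed.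

(** * The saddle, the critical parameter value and persistence *)

Lemma origin_hyperbolic_saddle mu delta lambda : 0 < mu -> 0 <= delta ->
  hyperbolic_saddle (field_u mu delta lambda 0) (field_v mu delta lambda 0) 0 0.
Proof.
intros Hmu Hdelta. unfold hyperbolic_saddle.
split; [reflexivity|]. split; [unfold field_v; ring|].
exists 0, 1, mu, 0. split; [|split].
- intros eps. exists (mkposreal 1 Rlt_0_1). intros u v _ _. unfold field_u.
  replace (v - 0 - (0 * (u - 0) + 1 * (v - 0))) with 0 by ring. rewrite Rabs_R0.
  apply Rmult_le_pos; [left; apply cond_pos|].
  eapply Rle_trans; [apply Rabs_pos|apply Rmax_l].
- intros eps.
  assert (Hd : 0 < Rmin 1 (eps / (delta + 1))).
  { apply Rmin_pos; [lra|]. apply Rdiv_lt_0_compat; [apply cond_pos|lra]. }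
  exists (mkposreal _ Hd). intros u v Hu _. simpl in Hu.
  rewrite !unperturbed_field. unfold nonlinearity.
  rewrite Rminus_0_r in Hu. rewrite !Rminus_0_r.
  assert (H1 : Rabs u < 1) by (eapply Rlt_le_trans; [exact Hu|apply Rmin_l]).
  assert (H2 : Rabs u * (delta + 1) < eps).
  { apply (Rmult_lt_reg_r (/ (delta + 1))); [apply Rinv_0_lt_compat; lra|].
    rewrite Rmult_assoc, Rinv_r, Rmult_1_r by lra.
    eapply Rlt_le_trans; [exact Hu|apply Rmin_r]. }
  replace (mu * u + delta * u ^ 2 - u ^ 3 - (mu * 0 + delta * 0 ^ 2 - 0 ^ 3) - (mu * u + 0 * v))
    with (u * (u * (delta - u))) by ring.
  rewrite !Rabs_mult.
  assert (H3 : Rabs (delta - u) <= delta + 1).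
  { apply Rabs_minus_le; [rewrite Rabs_pos_eq; lra|lra]. }
  apply Rle_trans with (eps * Rabs u).
  + assert (A := Rabs_pos u). assert (B := Rabs_pos (delta - u)).
    assert (Rabs u * Rabs (delta - u) <= eps) by nra. nra.
  + apply Rmult_le_compat_l; [left; apply cond_pos|apply Rmax_l].
- assert (Hom := sqrt_lt_R0 _ Hmu). assert (E : sqrt mu ^ 2 = mu) by (apply pow2_sqrt; lra).
  exists (- sqrt mu), (sqrt mu). split; [lra|]. split; [exact Hom|].
  split; [exists 1, (- sqrt mu)|exists 1, (sqrt mu)];
    (split; [intros Z; injection Z; lra|]; split; [ring|]; rewrite <- E at 1; ring).
Qed.

(** The loops lie on opposite sides of the line [u = 0], hence are distinct. *)
Lemma u0_pos_sign s mu delta t : 0 < mu -> 0 < pm s * u0 s mu delta t.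
Proof.
intros Hmu. rewrite u0_loop by exact Hmu.
assert (LD := loop_data_of s mu delta Hmu). assert (G := loop_gap LD).
assert (C1 := cosh_ge_1 (sqrt mu * t)). assert (W := loop_w_neq0 t LD).
assert (HKs : 0 <= pm s * loop_K s mu delta).
{ unfold loop_K. assert (Q := sqrt2_pos). assert (P := radicand_pos mu delta Hmu).
  replace (pm s * (pm s * sqrt (2 * delta ^ 2 + 9 * mu) / (3 * sqrt 2 * mu)))
    with (pm s ^ 2 * (sqrt (2 * delta ^ 2 + 9 * mu) / (3 * sqrt 2 * mu))) by (field; lra).
  rewrite pm_sqr, Rmult_1_l. left. apply Rdiv_lt_0_compat; [apply sqrt_lt_R0, P|].
  apply Rmult_lt_0_compat; lra. }
unfold loop_u.
replace (pm s * / _) with (/ (pm s * (loop_K s mu delta * cosh (sqrt mu * t) - loop_c mu delta))).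
2: { rewrite Rinv_mult. f_equal. destruct s; simpl; field. }
apply Rinv_0_lt_compat.
set (K := loop_K s mu delta) in *. set (c := loop_c mu delta) in *.
set (C := cosh (sqrt mu * t)) in *.
assert (Hc := Rle_abs c). assert (Hc' := Rle_abs (- c)). rewrite Rabs_Ropp in Hc'.
destruct s; simpl in *.
- rewrite (Rabs_pos_eq K) in G by lra. nra.
- rewrite (Rabs_left1 K) in G by lra. nra.
Qed.

Lemma u0_v0_homoclinic s mu delta lambda : 0 < mu ->
  homoclinic_solution mu delta lambda 0 (u0 s mu delta) (v0 s mu delta).
Proof.
intros Hmu. assert (LD := loop_data_of s mu delta Hmu).
assert (Hom := ld_om LD).
destruct (order_lim _ _ Hom (order_loop_u LD)) as [Um Up].
destruct (order_lim _ _ Hom (order_loop_v LD)) as [Vm Vp].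
split; [|split].
- intros t. unfold field_u. rewrite unperturbed_field. split.
  + apply (is_derive_ext (loop_u (sqrt mu) (loop_c mu delta) (loop_K s mu delta))).
    * intros r; symmetry; apply u0_loop, Hmu.
    * rewrite v0_loop by exact Hmu. apply (der_loop_u t LD).
  + apply (is_derive_ext (loop_v (sqrt mu) (loop_c mu delta) (loop_K s mu delta))).
    * intros r; symmetry; apply v0_loop, Hmu.
    * rewrite u0_loop by exact Hmu. apply (der_loop_v t LD).
- exists 0. intros Z. injection Z; intros _ Z'.
  generalize (u0_pos_sign s mu delta 0 Hmu). rewrite Z'. lra.
- repeat split.
  + eapply is_lim_ext; [|exact Um]. intros; symmetry; apply u0_loop, Hmu.
  + eapply is_lim_ext; [|exact Vm]. intros; symmetry; apply v0_loop, Hmu.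
  + eapply is_lim_ext; [|exact Up]. intros; symmetry; apply u0_loop, Hmu.
  + eapply is_lim_ext; [|exact Vp]. intros; symmetry; apply v0_loop, Hmu.
Qed.

Lemma loop_theta s mu delta : 0 < mu ->
  sqrt 2 * sqrt mu * (loop_K s mu delta + loop_c mu delta) = theta s mu delta.
Proof.
intros Hmu. assert (Q := sqrt2_pos). assert (Pm := sqrt_lt_R0 _ Hmu).
assert (E : sqrt mu ^ 2 = mu) by (apply pow2_sqrt; lra).
unfold loop_K, loop_c, theta.
set (r := sqrt (2 * delta ^ 2 + 9 * mu)). set (om := sqrt mu) in *. clearbody r om.
rewrite <- E. field. lra.
Qed.

Lemma I_int_integral s mu delta k : 0 < mu -> (k <= 2)%nat ->
  let F := moment_primitive mu delta (sqrt mu) (loop_c mu delta) (loop_K s mu delta) k in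
  exists l r : R,
   is_lim F m_infty l /\ is_lim F p_infty r /\
   is_RInt_gen (I_integrand k s mu delta) (Rbar_locally m_infty) (Rbar_locally p_infty) (r - l) /\
   I_int k s mu delta = r - l /\
   r - l = 4 * sqrt 2 * angle_coef mu delta k * atan (theta s mu delta)
           - 2 * sqrt mu * slope_coef mu delta k.
Proof.
intros Hmu Hk F. assert (LD := loop_data_of s mu delta Hmu).
destruct (moment_integral _ _ _ _ _ k LD Hk) as [l [r [Hl [Hr [Hv HI]]]]].
exists l, r. fold F in Hl, Hr.
assert (HI' : is_RInt_gen (I_integrand k s mu delta) (Rbar_locally m_infty) (Rbar_locally p_infty) (r - l)).
{ eapply is_RInt_gen_ext; [|exact HI].
  apply filter_forall. intros [x y] t _. unfold I_integrand.
  rewrite u0_loop, v0_loop by exact Hmu. reflexivity. }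
split; [exact Hl|]. split; [exact Hr|]. split; [exact HI'|]. split.
- apply (is_RInt_gen_unique (V := R_CompleteNormedModule)). exact HI'.
- rewrite Hv, loop_theta by exact Hmu. reflexivity.
Qed.

Lemma I_int_0 s mu delta : 0 < mu ->
  I_int 0 s mu delta = 4 / 405 * lambda_den s mu delta /\ 0 < I_int 0 s mu delta.
Proof.
intros Hmu. destruct (I_int_integral s mu delta 0 Hmu ltac:(lia)) as [l [r [Hl [Hr [_ [E V]]]]]].
split.
- rewrite E, V. unfold lambda_den, angle_coef, slope_coef. field.
- rewrite E. exact (zeroth_moment_pos _ _ _ _ _ l r (loop_data_of s mu delta Hmu) Hl Hr).
Qed.

Lemma I_int_combination s mu delta : 0 < mu ->
  3 * I_int 2 s mu delta - 2 * delta * I_int 1 s mu delta = 4 / 405 * lambda_num s mu delta.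
Proof.
intros Hmu.
destruct (I_int_integral s mu delta 1 Hmu ltac:(lia)) as [l1 [r1 [_ [_ [_ [E1 V1]]]]]].
destruct (I_int_integral s mu delta 2 Hmu ltac:(lia)) as [l2 [r2 [_ [_ [_ [E2 V2]]]]]].
rewrite E1, V1, E2, V2. unfold lambda_num, angle_coef, slope_coef. field.
Qed.

Lemma persists_lambda_pm s mu delta : 0 < mu -> 0 <= delta ->
  persists s mu delta (lambda_pm s mu delta).
Proof.
intros Hmu Hdelta. assert (LD := loop_data_of s mu delta Hmu).
assert (Hom := ld_om LD).
set (om := sqrt mu) in *. set (c := loop_c mu delta) in *. set (K := loop_K s mu delta) in *.
destruct (I_int_integral s mu delta 0 Hmu ltac:(lia)) as [l0 [r0 [Hl0 [Hr0 [_ [E0 _]]]]]].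
destruct (I_int_integral s mu delta 1 Hmu ltac:(lia)) as [l1 [r1 [Hl1 [Hr1 [_ [E1 _]]]]]].
destruct (I_int_integral s mu delta 2 Hmu ltac:(lia)) as [l2 [r2 [Hl2 [Hr2 [_ [E2 _]]]]]].
fold om c K in Hl0, Hr0, Hl1, Hr1, Hl2, Hr2.
assert (Hpos := zeroth_moment_pos _ _ _ _ _ l0 r0 LD Hl0 Hr0).
assert (HF := fun k t => der_moment_primitive _ _ _ _ _ k t LD).
set (F := moment_primitive mu delta om c K) in *.
destruct (loop_fundamental_system LD) as [M [HM FS]].
destruct (loop_persistence (om / 2) M mu delta (lambda_pm s mu delta) (loop_u om c K) (loop_v om c K)
  (fun t => nonlinearity mu delta (loop_u om c K t)) (sol2 om c K) (dsol2 om c K) (F 0%nat) (fun t => 2 * delta * F 1%nat t - 3 * F 2%nat t)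
  l0 r0 (2 * delta * l1 - 3 * l2) (2 * delta * r1 - 3 * r2) Hdelta)
  as [eta0 [C [Heta0 [HC HP]]]].
- intros t; apply (der_loop_u t LD).
- reflexivity.
- exact HM.
- exact FS.
- intros t. eapply der_val; [apply HF; lia|ring].
- exact Hl0.
- exact Hr0.
- exact Hpos.
- intros t. assert (D1 := HF 1%nat t ltac:(lia)). assert (D2 := HF 2%nat t ltac:(lia)).
  eapply der_val; [apply der_minus; (apply der_mult; [apply der_const|eassumption])|]. cbv beta. ring.
- apply is_lim_minus'; [apply (is_lim_scal_l _ _ _ l1), Hl1|apply (is_lim_scal_l _ _ _ l2), Hl2].
- apply is_lim_minus'; [apply (is_lim_scal_l _ _ _ r1), Hr1|apply (is_lim_scal_l _ _ _ r2), Hr2].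
- unfold lambda_pm. rewrite E0, E1, E2. field. lra.
- assert (HU0 : 0 < Rabs (loop_u om c K 0)).
  { apply Rabs_pos_lt. apply Rinv_neq_0_compat, (loop_w_neq0 0 LD). }
  (* below [eta1], the perturbed solution is at time 0 closer to the loop than
     the loop is to the line u = 0, so it is not the rest point *)
  pose (eta1 := Rmin eta0 (Rabs (loop_u om c K 0) / C)).
  assert (Heta1 : 0 < eta1) by (apply Rmin_pos; [exact Heta0|apply Rdiv_lt_0_compat; assumption]).
  pose (good := fun eta (p : R * (R -> R) * (R -> R)) =>
    Rabs (fst (fst p) - lambda_pm s mu delta) <= C * eta /\
    solution mu delta (fst (fst p)) eta (snd (fst p)) (snd p) /\
    forall t, Rabs (snd (fst p) t - loop_u om c K t) <= C * eta * weight (om / 2) t /\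
              Rabs (snd p t - loop_v om c K t) <= C * eta * weight (om / 2) t).
  pose (sel := fun eta => epsilon (inhabits (0, fun _ : R => 0, fun _ : R => 0)) (good eta)).
  assert (Hsel : forall eta, 0 < eta < eta0 -> good eta (sel eta)).
  { intros eta Heta. apply epsilon_spec. destruct (HP eta Heta) as [lam [U [V H]]].
    exists (lam, U, V). exact H. }
  assert (Hw : forall t, weight (om / 2) t <= 1) by (intros; apply weight_le_1; lra).
  exists eta1, (fun eta => fst (fst (sel eta))), (fun eta => snd (fst (sel eta))), (fun eta => snd (sel eta)).
  split; [exact Heta1|]. split; [|split].
  + exists C. exists (mkposreal _ Heta0). intros eta He He'.
    change (Rabs (eta - 0) < eta0) in He. rewrite Rminus_0_r, Rabs_pos_eq in He by lra.
    apply (Hsel eta). lra.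
  + intros eta [He0 He1].
    assert (He : eta < eta0) by (eapply Rlt_le_trans; [exact He1|apply Rmin_l]).
    assert (HeC : C * eta < Rabs (loop_u om c K 0)).
    { assert (eta < Rabs (loop_u om c K 0) / C) by (eapply Rlt_le_trans; [exact He1|apply Rmin_r]).
      apply Rlt_div_r in H; lra. }
    destruct (Hsel eta (conj He0 He)) as [_ [Hs Hb]].
    split; [exact Hs|]. split.
    * exists 0. intros Z. injection Z; intros _ Z'. destruct (Hb 0) as [B _].
      rewrite Z', Rminus_0_l, Rabs_Ropp in B.
      assert (0 <= C * eta) by nra. specialize (Hw 0). nra.
    * destruct (order_lim _ _ Hom (order_loop_u LD)) as [Um Up].
      destruct (order_lim _ _ Hom (order_loop_v LD)) as [Vm Vp].
      assert (L : forall (f g : R -> R) (z : Rbar),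
        (forall t, Rabs (f t - g t) <= C * eta * weight (om / 2) t) ->
        is_lim (weight (om / 2)) z 0 -> is_lim g z 0 -> is_lim f z 0).
      { intros f g z Hfg Hz Hg.
        apply (is_lim_ext (fun t => (f t - g t) + g t)); [intros; ring|].
        evar_last; [apply is_lim_plus'; [|exact Hg]|].
        - apply (is_lim_dominated _ _ z Hfg).
          now apply is_lim_scal_zero.
        - f_equal; ring. }
      assert (Wm := weight_lim_m (om / 2) ltac:(lra)). assert (Wp := weight_lim_p (om / 2) ltac:(lra)).
      split; [|split; [|split]].
      -- apply (L _ _ _ (fun t => proj1 (Hb t)) Wm Um).
      -- apply (L _ _ _ (fun t => proj2 (Hb t)) Wm Vm).
      -- apply (L _ _ _ (fun t => proj1 (Hb t)) Wp Up).
      -- apply (L _ _ _ (fun t => proj2 (Hb t)) Wp Vp).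
  + intros eps.
    assert (Hd : 0 < Rmin eta0 (eps / C))
      by (apply Rmin_pos; [exact Heta0|apply Rdiv_lt_0_compat; [apply cond_pos|exact HC]]).
    exists (mkposreal _ Hd). intros eta He He' t.
    change (Rabs (eta - 0) < Rmin eta0 (eps / C)) in He. rewrite Rminus_0_r, Rabs_pos_eq in He by lra.
    assert (He0 : eta < eta0) by (eapply Rlt_le_trans; [exact He|apply Rmin_l]).
    assert (HeC : C * eta < eps).
    { assert (eta < eps / C) by (eapply Rlt_le_trans; [exact He|apply Rmin_r]).
      apply Rlt_div_r in H; lra. }
    destruct (Hsel eta (conj He' He0)) as [_ [_ Hb]]. destruct (Hb t) as [B1 B2].
    rewrite u0_loop, v0_loop by exact Hmu. fold om c K.
    assert (0 <= C * eta) by nra. specialize (Hw t).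
    split; (eapply Rle_lt_trans; [eassumption|]); nra.
Qed.

Theorem mainTheorem4 :
  forall mu delta : R, 0 < mu -> 0 <= delta ->
    (forall lambda : R,
       hyperbolic_saddle (field_u mu delta lambda 0) (field_v mu delta lambda 0) 0 0 /\
       (forall s : loop_sign,
          homoclinic_solution mu delta lambda 0 (u0 s mu delta) (v0 s mu delta)) /\
       ~ (forall x y : R, Gamma0 Upper mu delta x y <-> Gamma0 Lower mu delta x y) /\
       (forall u v : R -> R, homoclinic_solution mu delta lambda 0 u v ->
          exists s : loop_sign, forall x y : R, orbit u v x y <-> Gamma0 s mu delta x y)) /\
    (forall (s : loop_sign) (x y : R), Gamma0 s mu delta x y -> Hfun mu delta x y = 0) /\
    (forall s : loop_sign,
       (forall k : nat, (k <= 2)%nat ->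
          ex_RInt_gen (I_integrand k s mu delta)
            (Rbar_locally m_infty) (Rbar_locally p_infty)) /\
       I_int 0 s mu delta <> 0 /\
       lambda_den s mu delta <> 0 /\
       lambda_pm s mu delta = lambda_num s mu delta / lambda_den s mu delta /\
       persists s mu delta (lambda_pm s mu delta)).
Proof.
intros mu delta Hmu Hdelta. split; [|split].
- intros lambda. split; [now apply origin_hyperbolic_saddle|]. split; [|split].
  + intros s; now apply u0_v0_homoclinic.
  + intros H.
    destruct (proj1 (H (u0 Upper mu delta 0) (v0 Upper mu delta 0))) as [t [Ht _]].
    { now exists 0. }
    generalize (u0_pos_sign Upper mu delta 0 Hmu) (u0_pos_sign Lower mu delta t Hmu).
    rewrite Ht; simpl; lra.
  + intros u v HH.
    destruct (homoclinic_classification _ _ _ _ _ Hmu HH) as [s [t0 E]].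
    exists s. intros x y. split; intros [t [-> ->]].
    * exists (t + t0). split; apply E.
    * exists (t - t0). destruct (E (t - t0)) as [-> ->].
      now replace (t - t0 + t0) with t by ring.
- intros s x y [t [-> ->]].
  apply (homoclinic_energy mu delta 0 _ _ (u0_v0_homoclinic s mu delta 0 Hmu)).
- intros s. destruct (I_int_0 s mu delta Hmu) as [E P].
  assert (HD : lambda_den s mu delta <> 0) by (intros Z; rewrite Z in E; lra).
  split; [|split; [lra|split; [exact HD|split]]].
  + intros k Hk. destruct (I_int_integral s mu delta k Hmu Hk) as [l [r [_ [_ [HI _]]]]].
    eexists; exact HI.
  + unfold lambda_pm. rewrite E, I_int_combination by exact Hmu. field. exact HD.
  + now apply persists_lambda_pm.
Qed.
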